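(* Let $(\mathfrak{B},\mathbf{B})$ be an ultrastable quasi-Banach ideal such that $\mathfrak{B}\subseteq\mathfrak{L}_\infty$. If $(\mathfrak{B}\circ\mathfrak{L}_2,\mathbf{B}\circ\mathbf{L}_2)$ is right-accessible, then $(\mathfrak{B}\circ\mathfrak{L}_2,\mathbf{B}\circ\mathbf{L}_2)$ cannot be a $1$-Banach ideal.
   Context: All Banach spaces are over $\mathbb{K}\in\{\mathbb{R},\mathbb{C}\}$; ''operator'' means bounded linear operator and $\mathfrak{L}(X,Y)$ is the space of all operators from $X$ to $Y$. Quasi-Banach (operator) ideals $(\mathfrak{A},\mathbf{A})$ are meant in the sense of Pietsch. $(\mathfrak{A},\mathbf{A})$ is a 1-Banach ideal (Banach ideal) if the given ideal quasi-norm $\mathbf{A}$ itself is a norm. $\mathfrak{A}\subseteq\mathfrak{B}$ means $\mathfrak{A}(X,Y)\subseteq\mathfrak{B}(X,Y)$ for all Banach spaces $X,Y$. Product ideal: $T\in(\mathfrak{A}\circ\mathfrak{B})(X,Y)$ iff $T=RS$ with $S\in\mathfrak{B}(X,Z)$, $R\in\mathfrak{A}(Z,Y)$ for some Banach space $Z$; $(\mathbf{A}\circ\mathbf{B})(T)=\inf\mathbf{A}(R)\,\mathbf{B}(S)$ over all such factorizations. $(\mathfrak{L}_2,\mathbf{L}_2)$: the operators that factor through a Hilbert space, $\mathbf{L}_2(T)=\inf\{\|R\|\|S\|: T=RS \text{ through a Hilbert space}\}$. Adjoint ideal: $\mathfrak{A}^{*}(X,Y)$ is the set of all $T\in\mathfrak{L}(X,Y)$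 with $\mathbf{A}^{*}(T):=\sup\{|\mathrm{tr}(TJ_E^XSQ_K^Y)|\}<\infty$, the supremum being over all finite-dimensional subspaces $E\subseteq X$, all closed finite-codimensional subspaces $K\subseteq Y$, and all $S\in\mathfrak{L}(Y/K,E)$ with $\mathbf{A}(S)\le1$; here $J_E^X:E\to X$ is the inclusion and $Q_K^Y:Y\to Y/K$ the quotient map. $(\mathfrak{P}_1,\mathbf{P}_1)$ is the ideal of absolutely 1-summing operators and $(\mathfrak{L}_\infty,\mathbf{L}_\infty):=(\mathfrak{P}_1^{*},\mathbf{P}_1^{*})$ its adjoint. Ultrastable: for every family $T_i\in\mathfrak{A}(X_i,Y_i)$ $(i\in I)$ with $\sup_i\mathbf{A}(T_i)<\infty$ and every ultrafilter $\mathcal{U}$ on $I$, the ultraproduct operator $(T_i)_{\mathcal{U}}:(X_i)_{\mathcal{U}}\to(Y_i)_{\mathcal{U}}$ belongs to $\mathfrak{A}$ and $\mathbf{A}((T_i)_{\mathcal{U}})\le\lim_{\mathcal{U}}\mathbf{A}(T_i)$. Right-accessible: $(\mathfrak{A},\mathbf{A})$ is right-accessible if for all finite-dimensional Banach spaces $E$, all Banach spaces $Y$, all $T\in\mathfrak{L}(E,Y)$ and $\varepsilon>0$ there are a finite-dimensional subspace $F\subseteq Y$ and $S\in\mathfrak{L}(E,F)$ with $T=J_F^YS$ and $\mathbf{A}(S)\le(1+\varepsilon)\mathbf{A}(T)$. *)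

(* Defs.v *)
From HB Require Import structures.
From mathcomp Require Import all_boot all_order all_algebra.
From mathcomp Require Import all_classical all_reals all_analysis.
From mathcomp Require Import complex sesquilinear generic_quotient ring_quotient.
From mathcomp Require Import lra ring.

Set Implicit Arguments.
Unset Strict Implicit.
Unset Printing Implicit Defensive.

Import Order.TTheory GRing.Theory Num.Theory.
Import numFieldNormedType.Exports.

Local Open Scope classical_set_scope.
Local Open Scope ring_scope.

Variant scalars := RealScalars | ComplexScalars.

Definition scalarK (R : realType) (s : scalars) : numFieldType :=
  match s with RealScalars => R | ComplexScalars => (R[i] : numFieldType) end.

Section Scalar.
Variables (R : realType) (s : scalars).
Local Notation K := (scalarK R s).

Definition conjs : K -> K :=
  match s return scalarK R s -> scalarK R s with
  | RealScalars => fun z => z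
  | ComplexScalars => fun z => conjc z
  end.

(* The real part; it is only applied to norms. *)
Definition res : K -> R :=
  match s return scalarK R s -> R with
  | RealScalars => fun z => z
  | ComplexScalars => fun z => complex.Re z
  end.

Definition emb : R -> K :=
  match s return R -> scalarK R s with
  | RealScalars => fun x => x
  | ComplexScalars => fun x => Complex x 0
  end.

Lemma embK x : res (emb x) = x.
Proof. by rewrite /res /emb; case: s. Qed.

Lemma emb0 : emb 0 = 0.
Proof. by rewrite /emb; case: s. Qed.

Lemma emb1 : emb 1 = 1.
Proof. by rewrite /emb; case: s. Qed.

Lemma embD x y : emb (x + y) = emb x + emb y.
Proof.
by rewrite /emb; case: s => //; apply: (rmorphD (real_complex R)).
Qed.

Lemma embM x y : emb (x * y) = emb x * emb y.
Proof.
by rewrite /emb; case: s => //; apply: (rmorphM (real_complex R)).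
Qed.

Lemma le_emb x y : (emb x <= emb y) = (x <= y).
Proof. by rewrite /emb; case: s => //; rewrite /= lecR. Qed.

Lemma lt_emb x y : (emb x < emb y) = (x < y).
Proof. by rewrite /emb; case: s => //; rewrite /= ltcR. Qed.

Lemma resK (a : K) : 0 <= a -> emb (res a) = a.
Proof.
rewrite /res /emb; move: a; case: s => //= -[x y].
by rewrite lecE /= => /andP[/eqP -> _].
Qed.

Lemma emb_ge0 x : 0 <= x -> 0 <= emb x.
Proof. by rewrite -[0 in X in _ -> X]emb0 le_emb. Qed.

Lemma emb_gt0 x : 0 < x -> 0 < emb x.
Proof. by rewrite -[0 in X in _ -> X]emb0 lt_emb. Qed.

End Scalar.

Arguments emb {R s}.
Arguments res {R s}.
Arguments conjs {R s}.

Section RealNorm.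
Variables (R : realType) (s : scalars).
Local Notation K := (scalarK R s).

Section Def.
Variable V : normedModType K.

Definition rnorm (x : V) : R := res `|x|.

Lemma emb_rnorm x : emb (rnorm x) = `|x|.
Proof. by rewrite /rnorm resK. Qed.

Lemma rnorm_ge0 x : 0 <= rnorm x.
Proof. by rewrite -(@le_emb _ s) emb_rnorm emb0. Qed.

Lemma rnorm0 : rnorm 0 = 0.
Proof. by rewrite /rnorm normr0 -(emb0 R s) embK. Qed.

Lemma rnorm0_eq0 x : rnorm x = 0 -> x = 0.
Proof. by move=> x0; apply/normr0_eq0; rewrite -emb_rnorm x0 emb0. Qed.

Lemma rnormD x y : rnorm (x + y) <= rnorm x + rnorm y.
Proof. by rewrite -(@le_emb _ s) embD !emb_rnorm ler_normD. Qed.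

Lemma rnormN x : rnorm (- x) = rnorm x.
Proof. by rewrite /rnorm normrN. Qed.

Lemma rnormC x y : rnorm (x - y) = rnorm (y - x).
Proof. by rewrite -rnormN opprB. Qed.

Lemma rnorm_tri z x y : rnorm (x - y) <= rnorm (x - z) + rnorm (z - y).
Proof. by rewrite -[x - y](subrKA z) rnormD. Qed.

Definition cvg_seq (u : nat -> V) (l : V) := forall e : R, 0 < e ->
  exists N, forall n, (N <= n)%N -> rnorm (u n - l) <= e.

Definition rapid (c : R) (u : nat -> V) :=
  forall n, rnorm (u n.+1 - u n) <= c * 2^-1 ^+ n.

Lemma rapid_dist c u n m : rapid c u -> (n <= m)%N ->
  rnorm (u m - u n) <= c * 2 * 2^-1 ^+ n - c * 2 * 2^-1 ^+ m.
Proof.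
move=> ru /subnK <-; elim: (m - n)%N => [|k IH].
  by rewrite add0n !subrr rnorm0.
rewrite addSn (le_trans (rnorm_tri (u (k + n)%N) _ _))//.
have := ru (k + n)%N; rewrite exprS; lra.
Qed.

Lemma half_small (c e : R) : 0 < e -> 
  exists N, forall n, (N <= n)%N -> c * 2^-1 ^+ n <= e.
Proof.
move=> e0.
have h : (fun n : nat => c * (2^-1 : R) ^+ n) @ \oo --> (c * 0 : R).
  by apply: cvgMr; apply: cvg_expr; rewrite ger0_norm ?invr_ge0// invf_lt1// ltr1n.
rewrite mulr0 in h.
have /cvgr_le/(_ e e0) := h.
move=> [N _ HN]; exists N => n Nn; exact: HN.
Qed.

Lemma rapid_cvg (c : R) u l : 0 <= c -> rapid c u -> cvg_seq u l ->
  forall n, rnorm (u n - l) <= c * 2 * 2^-1 ^+ n.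
Proof.
move=> c0 ru ul n; apply/ler_addgt0Pr => e e0.
have [N HN] := ul e e0.
have h1 := HN (maxn N n) (leq_maxl _ _).
have h2 := rapid_dist ru (leq_maxr N n).
have h3 := rnorm_tri (u (maxn N n)) (u n) l.
rewrite rnormC in h2.
have h4 : 0 <= c * 2 * 2^-1 ^+ maxn N n.
  by rewrite !mulr_ge0// exprn_ge0// invr_ge0.
lra.
Qed.

Lemma rapid_complete :
  (forall u : nat -> V, rapid 1 u -> exists l, cvg_seq u l) ->
  forall F : set_system V, ProperFilter F -> cauchy F -> cvg F.
Proof.
move=> H F FF /(cauchyP F) cF.
pose d n : R := 2^-1 ^+ n / 4.
have d0 n : 0 < d n by rewrite divr_gt0// exprn_gt0// invr_gt0.
have [u Fu] : {u : nat -> V & forall n, F (ball (u n) (emb (d n)))}.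
  apply: (@choice _ _ (fun n x => F (ball x (emb (d n))))) => n.
  by apply: cF; exact: emb_gt0.
have Bd x y n : ball x (emb (d n)) y -> rnorm (x - y) < d n.
  by rewrite -ball_normE /= -emb_rnorm lt_emb.
have [|l ul] := H u.
  move=> n.
  have [z [/Bd h1 /Bd h2]] := filter_ex (filterI (Fu n) (Fu n.+1)).
  have h3 := rnorm_tri z (u n.+1) (u n).
  rewrite (rnormC z) in h3.
  have h4 : d n.+1 = d n / 2 by rewrite /d exprS; lra.
  have h5 : 2^-1 ^+ n = d n * 4 by rewrite /d; lra.
  have := d0 n; rewrite h5; lra.
apply/cvg_ex; exists l; apply/cvgrPdist_le => /= e e0.
have [r r0 ->] : exists2 r : R, 0 < r & e = emb r.
  exists (res e); last by rewrite resK// ltW.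
  by rewrite -(@lt_emb _ s) resK ?emb0// ltW.
have r2 : 0 < r / 2 by rewrite divr_gt0.
have [N HN] := ul _ r2.
have [M HM] := half_small 1 r2.
have h1 := HN _ (leq_maxl N M).
have h2 := HM _ (leq_maxr N M).
apply: filterS (Fu (maxn N M)) => y /Bd h3.
rewrite -emb_rnorm le_emb.
have h4 := rnorm_tri (u (maxn N M)) l y.
rewrite (rnormC l (u _)) in h4.
have h5 : 2^-1 ^+ (maxn N M) = d (maxn N M) * 4 by rewrite /d; lra.
have := d0 (maxn N M); lra.
Qed.

End Def.

Lemma rnormZ (V : normedModType K) (a : K) (x : V) :
  rnorm (a *: x) = res `|a| * rnorm x.
Proof. by rewrite /rnorm normrZ -(resK (normr_ge0 a)) -emb_rnorm -embM !embK. Qed.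

Lemma complete_rapid (V : completeNormedModType K) (c : R) (u : nat -> V) :
  0 <= c -> rapid c u -> exists l, cvg_seq u l.
Proof.
move=> c0 ru.
have : cauchy (u @ \oo).
  apply/cauchyP => e e0.
  have [r r0 ->] : exists2 r : R, 0 < r & e = emb r.
    exists (res e); last by rewrite resK// ltW.
    by rewrite -(@lt_emb _ s) resK ?emb0// ltW.
  have r2 : 0 < r / 2 by rewrite divr_gt0.
  have [N HN] := half_small (c * 2) r2.
  exists (u N); exists N => // n /= Nn.
  rewrite -ball_normE /= -emb_rnorm lt_emb rnormC.
  have h := rapid_dist ru Nn.
  have h1 := HN N (leqnn _).
  have h4 : 0 <= c * 2 * 2^-1 ^+ n by rewrite !mulr_ge0// exprn_ge0// invr_ge0.
  lra.
move=> /cauchy_cvg /cvg_ex[l ul]; exists l => e e0.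
have /cvgrPdist_le/(_ _ (emb_gt0 s e0)) := ul.
move=> [N _ HN]; exists N => n Nn.
by have := HN n Nn; rewrite -emb_rnorm le_emb rnormC.
Qed.

End RealNorm.

Definition scalar_space (R : realType) (s : scalars) : Type := scalarK R s.

Section ScalarSpace.
Variables (R : realType) (s : scalars).
Local Notation K := (scalarK R s).

HB.instance Definition _ := NormedModule.copy (scalar_space R s) (K^o).

Lemma cvg_seq_real (c : R) (u : nat -> R) : 0 <= c ->
  (forall n, `|u n.+1 - u n| <= c * 2^-1 ^+ n) ->
  exists l, forall e : R, 0 < e ->
  exists N, forall n, (N <= n)%N -> `|u n - l| <= e.
Proof.
move=> c0 ru.
have [l H] := @complete_rapid R RealScalars R^o c u c0 ru.
by exists l.
Qed.

End ScalarSpace.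

Lemma scalar_space_rapid (R : realType) (s : scalars)
  (u : nat -> scalar_space R s) : rapid 1 u -> exists l, cvg_seq u l.
Proof.
case: s u => u ru.
  have [l H] := @cvg_seq_real R 1 u ler01 ru.
  by exists l.
have nRe (z : R[i]) : `|complex.Re z| <= complex.Re `|z|.
  by case: z => x y /=; rewrite -sqrtr_sqr ler_wsqrtr// lerDl sqr_ge0.
have nIm (z : R[i]) : `|complex.Im z| <= complex.Re `|z|.
  by case: z => x y /=; rewrite -sqrtr_sqr ler_wsqrtr// lerDr sqr_ge0.
have [a Ha] : exists a, forall e : R, 0 < e ->
    exists N, forall n, (N <= n)%N -> `|complex.Re (u n) - a| <= e.
  apply: (@cvg_seq_real R 1) => // n; apply: le_trans (ru n).
  apply: le_trans (nRe _).
  by move: (u n.+1) (u n) => [? ?] [? ?].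
have [b Hb] : exists b, forall e : R, 0 < e ->
    exists N, forall n, (N <= n)%N -> `|complex.Im (u n) - b| <= e.
  apply: (@cvg_seq_real R 1) => // n; apply: le_trans (ru n).
  apply: le_trans (nIm _).
  by move: (u n.+1) (u n) => [? ?] [? ?].
exists (Complex a b) => e e0.
have e2 : 0 < e / 2 by rewrite divr_gt0.
have [N HN] := Ha _ e2; have [M HM] := Hb _ e2.
exists (maxn N M) => n; rewrite geq_max => /andP[/HN h1 /HM h2].
move: h1 h2; rewrite /rnorm /res /=.
move: (u n) => [x y] /= h1 h2.
have : Num.sqrt ((x - a) ^+ 2 + (y - b) ^+ 2) <= `|x - a| + `|y - b|.
  have p0 : 0 <= `|x - a| + `|y - b| by rewrite addr_ge0.
  rewrite -[leRHS](ger0_norm p0) -[leRHS]sqrtr_sqr ler_wsqrtr//.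
  by rewrite [leRHS]sqrrD !real_normK ?num_real// addrAC lerDl mulrn_wge0// mulr_ge0.
lra.
Qed.

HB.instance Definition _ (R : realType) (s : scalars) :=
  Uniform_isComplete.Build (scalar_space R s)
    (rapid_complete (@scalar_space_rapid R s)).

Section ClosedSubspace.
Variables (R : realType) (s : scalars).
Local Notation K := (scalarK R s).
Variable V : completeNormedModType K.

Record closed_subspace := ClosedSubspace {
  carrier : set V;
  carrier0 : carrier 0;
  carrier_linear : forall (a : K) (x y : V),
    carrier x -> carrier y -> carrier (a *: x + y);
  carrier_closed : closed carrier
}.

Definition sub_pred (E : closed_subspace) : {pred V} := fun x => x \in carrier E.

Fact sub_pred_submod E : GRing.submod_closed (sub_pred E).
Proof.
split=> [|a x y]; rewrite !unfold_in /sub_pred ?inE; first exact: carrier0.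
exact: carrier_linear.
Qed.

HB.instance Definition _ E :=
  GRing.isSubmodClosed.Build K V (sub_pred E) (sub_pred_submod E).

Record subspace_type (E : closed_subspace) : Type :=
  SubspaceElt { subsp_incl : V; subsp_inclP : subsp_incl \in sub_pred E }.

HB.instance Definition _ E := [isSub for @subsp_incl E].
HB.instance Definition _ E := [Choice of subspace_type E by <:].
HB.instance Definition _ E :=
  [SubChoice_isSubLmodule of subspace_type E by <:].

Section Subspace.
Variable E : closed_subspace.

Lemma incl_linear : linear (@subsp_incl E).
Proof. by []. Qed.

Definition sub_norm (x : subspace_type E) : K := `|subsp_incl x|.

Fact sub_normD x y : sub_norm (x + y) <= sub_norm x + sub_norm y.
Proof. exact: ler_normD. Qed.

Fact sub_normZ a x : sub_norm (a *: x) = `|a| * sub_norm x.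
Proof. by rewrite /sub_norm -normrZ. Qed.

Fact sub_norm_eq0 x : sub_norm x = 0 -> x = 0.
Proof. by move=> /normr0_eq0 x0; apply: val_inj. Qed.

HB.instance Definition _ :=
  Lmodule_isNormed.Build K (subspace_type E) sub_normD sub_normZ sub_norm_eq0.

Lemma rnorm_incl (x : subspace_type E) : rnorm (subsp_incl x) = rnorm x.
Proof. by []. Qed.

Lemma closed_cvg_seq (A : set V) (u : nat -> V) l :
  closed A -> (forall n, A (u n)) -> cvg_seq u l -> A l.
Proof.
move=> cA Au ul; apply: (closed_cvg A cA (F := \oo) (u_ := u)).
  exact: nearW.
apply/cvgrPdist_le => /= e e0.
have r0 : 0 < res e by rewrite -(@lt_emb _ s) resK ?emb0// ltW.
have [N HN] := ul _ r0.
exists N => // n /= Nn; rewrite -(resK (ltW e0)) -emb_rnorm le_emb rnormC.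
exact: HN.
Qed.

Fact subspace_rapid (u : nat -> subspace_type E) :
  rapid 1 u -> exists l, cvg_seq u l.
Proof.
move=> ru.
have [||l ul] := @complete_rapid R s V 1 (fun n => subsp_incl (u n)) => //.
have El : l \in sub_pred E.
  rewrite unfold_in inE; apply: (closed_cvg_seq (@carrier_closed E) _ ul) => n.
  by have := subsp_inclP (u n); rewrite unfold_in inE.
by exists (SubspaceElt El).
Qed.

HB.instance Definition _ :=
  Uniform_isComplete.Build (subspace_type E) (rapid_complete subspace_rapid).

End Subspace.

Section Quotient.
Variable M : closed_subspace.

Definition quotient_type : Type := Quotient.quot (sub_pred M : zmodClosed V).

HB.instance Definition _ := GRing.Zmodule.on quotient_type.

Definition qmap (x : V) : quotient_type := (\pi x)%qT.

Lemma qmapE x y : qmap x = qmap y <-> carrier M (x - y).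
Proof.
have -> : carrier M (x - y) = (x - y \in sub_pred M) by rewrite unfold_in inE.
rewrite (Quotient.idealrBE (sub_pred M : zmodClosed V)).
by split=> /eqP.
Qed.

Lemma qmap_surj q : exists x, qmap x = q.
Proof. by exists (repr q); exact: reprK. Qed.

Fact qmapD x y : qmap (x + y) = qmap x + qmap y.
Proof. by rewrite /qmap Quotient.pi_add. Qed.

Definition quotient_scale (a : K) (q : quotient_type) : quotient_type :=
  qmap (a *: repr q).

Fact qmapZ a x : qmap (a *: x) = quotient_scale a (qmap x).
Proof.
apply/qmapE; rewrite -scalerBr.
have : carrier M (x - repr (qmap x)) by apply/qmapE; rewrite /qmap reprK.
by move=> /(carrier_linear a)/(_ (carrier0 M)); rewrite addr0.
Qed.

Fact quotient_scaleA a b v :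
  quotient_scale a (quotient_scale b v) = quotient_scale (a * b) v.
Proof. by have [x <-] := qmap_surj v; rewrite -!qmapZ scalerA. Qed.

Fact quotient_scale1 : left_id 1 quotient_scale.
Proof. by move=> v; have [x <-] := qmap_surj v; rewrite -!qmapZ scale1r. Qed.

Fact quotient_scaleDr : right_distributive quotient_scale +%R.
Proof.
move=> a u v; have [x <-] := qmap_surj u; have [y <-] := qmap_surj v.
by rewrite -qmapD -!qmapZ -qmapD scalerDr.
Qed.

Fact quotient_scaleDl v :
  {morph quotient_scale^~ v : a b / a + b}.
Proof.
by move=> a b /=; have [x <-] := qmap_surj v; rewrite -!qmapZ -qmapD scalerDl.
Qed.

HB.instance Definition _ := GRing.Zmodule_isLmodule.Build K quotient_type
  quotient_scaleA quotient_scale1 quotient_scaleDr quotient_scaleDl.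

Lemma qmap_linear : linear qmap.
Proof. by move=> a x y; rewrite qmapD qmapZ. Qed.

Lemma qmap0 : qmap 0 = 0.
Proof. by rewrite -(scale0r (0 : V)) qmapZ; apply: (scale0r (qmap 0)). Qed.

Lemma qmapN x : qmap (- x) = - qmap x.
Proof. by apply/eqP; rewrite -addr_eq0 -qmapD addNr qmap0. Qed.

Lemma qmapB x y : qmap (x - y) = qmap x - qmap y.
Proof. by rewrite qmapD qmapN. Qed.

Definition quotient_rnorm (q : quotient_type) : R :=
  inf [set rnorm x | x in [set x | qmap x = q]].

Definition quotient_norm (q : quotient_type) : K := emb (quotient_rnorm q).

Let nonempty q : [set rnorm x | x in [set x | qmap x = q]] !=set0.
Proof. by have [x xq] := qmap_surj q; exists (rnorm x); exists x. Qed.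

Let lbounded q : has_lbound [set rnorm x | x in [set x | qmap x = q]].
Proof. by exists 0 => _ [x _ <-]; exact: rnorm_ge0. Qed.

Lemma quotient_rnorm_le x : quotient_rnorm (qmap x) <= rnorm x.
Proof. by apply: ge_inf => //; exists x. Qed.

Lemma quotient_rnorm_lt q (e : R) : 0 < e ->
  exists2 x, qmap x = q & rnorm x < quotient_rnorm q + e.
Proof.
move=> e0.
have [_ [x xq <-] xe] := @inf_adherent _ _ e e0 (conj (nonempty q) (lbounded q)).
by exists x.
Qed.

Lemma quotient_rnorm_ge0 q : 0 <= quotient_rnorm q.
Proof. by apply: lb_le_inf => // _ [x _ <-]; exact: rnorm_ge0. Qed.

Fact quotient_normD p q :
  quotient_norm (p + q) <= quotient_norm p + quotient_norm q.
Proof.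
rewrite /quotient_norm -embD le_emb; apply/ler_addgt0Pr => e e0.
have e2 : 0 < e / 2 by rewrite divr_gt0.
have [x <- hx] := quotient_rnorm_lt p e2.
have [y <- hy] := quotient_rnorm_lt q e2.
rewrite -qmapD.
have := quotient_rnorm_le (x + y); have := rnormD x y; lra.
Qed.

Fact quotient_normZ_le a q :
  quotient_rnorm (a *: q) <= res `|a| * quotient_rnorm q.
Proof.
have a0 : 0 <= res `|a| by exact: (@rnorm_ge0 _ _ (scalar_space R s) a).
apply/ler_addgt0Pr => e e0.
have e2 : 0 < e / (res `|a| + 1) by rewrite divr_gt0// ltr_wpDl.
have [x <- hx] := quotient_rnorm_lt q e2.
rewrite -[a *: _]/(quotient_scale a _) -qmapZ.
apply: le_trans (quotient_rnorm_le _) _; rewrite rnormZ.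
apply: le_trans (ler_wpM2l a0 (ltW hx)) _; rewrite mulrDr lerD2l.
rewrite mulrCA ger_pMr// ler_pdivrMr ?ltr_wpDl// mul1r lerDl//.
Qed.

Fact quotient_normZ a q : quotient_norm (a *: q) = `|a| * quotient_norm q.
Proof.
rewrite /quotient_norm -(resK (normr_ge0 a)) -embM; congr emb.
apply/eqP; rewrite eq_le quotient_normZ_le /=.
have [->|a0] := eqVneq a 0.
  by rewrite normr0 -(emb0 R s) embK mul0r quotient_rnorm_ge0.
have h := quotient_normZ_le a^-1 (a *: q).
rewrite scalerA mulVf// scale1r in h.
have n0 : 0 < `|a| by rewrite normr_gt0.
have r0 : 0 < res `|a| by rewrite -(@lt_emb _ s) emb0 resK// ltW.
have : res `|a^-1| * res `|a| = 1 :> R.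
  apply: (can_inj (@embK R s)); rewrite embM !resK// emb1.
  by rewrite -normrM mulVf// normr1.
move=> e1; have := ler_wpM2l (ltW r0) h.
by rewrite mulrA [res _ * res _]mulrC e1 mul1r.
Qed.

Fact quotient_norm_eq0 q : quotient_norm q = 0 -> q = 0.
Proof.
have [x <-] := qmap_surj q.
rewrite /quotient_norm -(emb0 R s) => /(can_inj (@embK R s)) q0.
suff : carrier M x by move=> Mx; rewrite -qmap0; apply/qmapE; rewrite subr0.
have H n : exists y : V, carrier M y /\ rnorm (y - x) <= 2^-1 ^+ n.
  have e0 : (0 : R) < 2^-1 ^+ n by rewrite exprn_gt0// invr_gt0.
  have [y /qmapE My hy] := quotient_rnorm_lt (qmap x) e0.
  exists (- (y - x)); split.
    by have := carrier_linear (-1) My (carrier0 M); rewrite scaleN1r addr0.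
  have -> : - (y - x) - x = - y by rewrite opprB addrC addKr.
  by rewrite rnormN; rewrite q0 add0r in hy; exact: ltW.
have [y Hy] := choice H.
apply: (closed_cvg_seq (@carrier_closed M) (fun n => (Hy n).1)) => e e0.
have [N HN] := half_small 1 e0.
exists N => n Nn; apply: le_trans (Hy n).2 _.
by have := HN n Nn; rewrite mul1r.
Qed.

HB.instance Definition _ := Lmodule_isNormed.Build K quotient_type
  quotient_normD quotient_normZ quotient_norm_eq0.

Lemma rnorm_quotient (q : quotient_type) : rnorm q = quotient_rnorm q.
Proof. by rewrite /rnorm embK. Qed.

Fact quotient_rapid (u : nat -> quotient_type) :
  rapid 1 u -> exists l, cvg_seq u l.
Proof.
move=> ru.
have [v0 v0E] := qmap_surj (u 0%N).
have H n : exists w : V, qmap w = u n.+1 - u n /\ rnorm w <= 2 * 2^-1 ^+ n.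
  have e0 : (0 : R) < 2^-1 ^+ n by rewrite exprn_gt0// invr_gt0.
  have [w wE hw] := quotient_rnorm_lt (u n.+1 - u n) e0.
  exists w; split=> //; have := ru n; rewrite rnorm_quotient; lra.
have [w Hw] := choice H.
pose v n := v0 + \sum_(i < n) w i.
have vS n : v n.+1 = v n + w n by rewrite /v big_ord_recr /= addrA.
have vE n : qmap (v n) = u n.
  elim: n => [|n IH]; first by rewrite /v big_ord0 addr0.
  by rewrite vS qmapD (Hw n).1 IH addrC subrK.
have [||l vl] := @complete_rapid R s V 2 v => //.
  move=> n; rewrite vS [v n + _]addrC addrK.
  exact: (Hw n).2.
exists (qmap l) => e e0; have [N HN] := vl e e0.
exists N => n Nn; rewrite rnorm_quotient -vE -qmapB.
exact: le_trans (quotient_rnorm_le _) (HN n Nn).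
Qed.

HB.instance Definition _ :=
  Uniform_isComplete.Build quotient_type (rapid_complete quotient_rapid).

End Quotient.
End ClosedSubspace.

Section LInfinity.
Variables (R : realType) (s : scalars).
Local Notation K := (scalarK R s).
Variables (I : Type) (X : I -> completeNormedModType K).

Definition bounded_family (x : forall i, X i) : Prop :=
  exists C : R, forall i, rnorm (x i) <= C.

(* Bounded families (x_i) under the norm sup_i |x_i|. *)
Record linf : Type := LInf { lval : forall i, X i; lvalP : bounded_family lval }.

HB.instance Definition _ := gen_eqMixin linf.
HB.instance Definition _ := gen_choiceMixin linf.

Lemma linf_ext (x y : linf) : (forall i, lval x i = lval y i) -> x = y.
Proof.
case: x y => [x xP] [y yP] /= xy.
have xy' : x = y by apply: functional_extensionality_dep.
by subst y; congr LInf; exact: Prop_irrelevance.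
Qed.

Fact linf0_subproof : bounded_family (fun i => 0).
Proof. by exists 0 => i; rewrite rnorm0. Qed.
Fact linfD_subproof (x y : linf) : bounded_family (fun i => lval x i + lval y i).
Proof.
have [C hC] := lvalP x; have [D hD] := lvalP y.
by exists (C + D) => i; rewrite (le_trans (rnormD _ _))// lerD.
Qed.
Fact linfN_subproof (x : linf) : bounded_family (fun i => - lval x i).
Proof. by have [C hC] := lvalP x; exists C => i; rewrite rnormN. Qed.
Fact linfZ_subproof (a : K) (x : linf) : bounded_family (fun i => a *: lval x i).
Proof.
have [C hC] := lvalP x; exists (res `|a| * C) => i; rewrite rnormZ.
by rewrite ler_wpM2l// (@rnorm_ge0 _ _ (scalar_space R s) a).
Qed.

Definition linf0 := LInf linf0_subproof.
Definition linfD x y := LInf (linfD_subproof x y).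
Definition linfN x := LInf (linfN_subproof x).
Definition linfZ a x := LInf (linfZ_subproof a x).

Fact linfDA : associative linfD.
Proof. by move=> x y z; apply: linf_ext => i /=; rewrite addrA. Qed.
Fact linfDC : commutative linfD.
Proof. by move=> x y; apply: linf_ext => i /=; rewrite addrC. Qed.
Fact linf0D : left_id linf0 linfD.
Proof. by move=> x; apply: linf_ext => i /=; rewrite add0r. Qed.
Fact linfND : left_inverse linf0 linfN linfD.
Proof. by move=> x; apply: linf_ext => i /=; rewrite addNr. Qed.

HB.instance Definition _ := GRing.isZmodule.Build linf linfDA linfDC linf0D linfND.

Fact linfZA a b v : linfZ a (linfZ b v) = linfZ (a * b) v.
Proof. by apply: linf_ext => i /=; rewrite scalerA. Qed.
Fact linf1Z : left_id 1 linfZ.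
Proof. by move=> v; apply: linf_ext => i /=; rewrite scale1r. Qed.
Fact linfZDr : right_distributive linfZ +%R.
Proof. by move=> a u v; apply: linf_ext => i /=; rewrite scalerDr. Qed.
Fact linfZDl v : {morph linfZ^~ v : a b / a + b}.
Proof. by move=> a b; apply: linf_ext => i /=; rewrite scalerDl. Qed.

HB.instance Definition _ :=
  GRing.Zmodule_isLmodule.Build K linf linfZA linf1Z linfZDr linfZDl.

Definition linf_rnorm (x : linf) : R := sup [set rnorm (lval x i) | i in setT].
Definition linf_norm (x : linf) : K := emb (linf_rnorm x).

Lemma linf_rnorm_ub x i : rnorm (lval x i) <= linf_rnorm x.
Proof.
apply: ub_le_sup; last by exists i.
by have [C hC] := lvalP x; exists C => _ [j _ <-].
Qed.

Lemma linf_rnorm_le x C : 0 <= C -> (forall i, rnorm (lval x i) <= C) ->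
  linf_rnorm x <= C.
Proof.
move=> C0 xC; rewrite /linf_rnorm; set A := [set _ | _ in _].
have [->|/set0P A0] := eqVneq A set0; first by rewrite sup0.
by apply: ge_sup => // _ [i _ <-].
Qed.

Lemma linf_rnorm_ge0 x : 0 <= linf_rnorm x.
Proof.
rewrite /linf_rnorm; set A := [set _ | _ in _].
have [->|/set0P [_ [i _ _]]] := eqVneq A set0; first by rewrite sup0.
exact: le_trans (rnorm_ge0 _) (linf_rnorm_ub x i).
Qed.

Fact linf_normD x y : linf_norm (x + y) <= linf_norm x + linf_norm y.
Proof.
rewrite /linf_norm -embD le_emb linf_rnorm_le ?addr_ge0 ?linf_rnorm_ge0//.
by move=> i; rewrite (le_trans (rnormD _ _))// lerD// linf_rnorm_ub.
Qed.

Fact linf_normZ a x : linf_norm (a *: x) = `|a| * linf_norm x.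
Proof.
rewrite /linf_norm -(resK (normr_ge0 a)) -embM; congr emb.
have a0 : 0 <= res `|a| by exact: (@rnorm_ge0 _ _ (scalar_space R s) a).
apply/eqP; rewrite eq_le; apply/andP; split.
  apply: linf_rnorm_le => [|i]; first by rewrite mulr_ge0// linf_rnorm_ge0.
  by rewrite rnormZ ler_wpM2l// linf_rnorm_ub.
have [r0|r0] := eqVneq (res `|a|) 0; first by rewrite r0 mul0r linf_rnorm_ge0.
have {}r0 : 0 < res `|a| by rewrite lt_def r0.
rewrite -ler_pdivlMl// linf_rnorm_le// => [|i].
  by rewrite mulr_ge0 ?invr_ge0// linf_rnorm_ge0.
by rewrite ler_pdivlMl// -rnormZ (linf_rnorm_ub (a *: x) i).
Qed.

Fact linf_norm_eq0 x : linf_norm x = 0 -> x = 0.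
Proof.
rewrite /linf_norm -(emb0 R s) => /(can_inj (@embK R s)) x0.
apply: linf_ext => i; apply: rnorm0_eq0; apply/eqP.
by rewrite eq_le rnorm_ge0 andbT -x0 linf_rnorm_ub.
Qed.

HB.instance Definition _ := Lmodule_isNormed.Build K linf
  linf_normD linf_normZ linf_norm_eq0.

Lemma rnorm_linf (x : linf) : rnorm x = linf_rnorm x.
Proof. by rewrite /rnorm embK. Qed.

Lemma rnorm_lval (x : linf) i : rnorm (lval x i) <= rnorm x.
Proof. by rewrite rnorm_linf linf_rnorm_ub. Qed.

Fact linf_rapid (u : nat -> linf) : rapid 1 u -> exists l, cvg_seq u l.
Proof.
move=> ru.
have rui i : rapid 1 (fun n => lval (u n) i).
  by move=> n; exact: le_trans (rnorm_lval (u n.+1 - u n) i) (ru n).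
have L i : {l : X i | cvg_seq (fun n => lval (u n) i) l}.
  by apply: cid; exact: (complete_rapid ler01 (rui i)).
pose l i := projT1 (L i).
have Hl i : cvg_seq (fun n => lval (u n) i) (l i) := projT2 (L i).
have dl n i : rnorm (lval (u n) i - l i) <= 2 * 2^-1 ^+ n.
  by have := rapid_cvg ler01 (rui i) (Hl i) n; rewrite mul1r.
have lP : bounded_family l.
  exists (rnorm (u 0%N) + 2) => i.
  have := dl 0%N i; have := rnorm_lval (u 0%N) i.
  have := rnorm_tri (lval (u 0%N) i) 0 (l i).
  rewrite !sub0r !rnormN expr0; lra.
exists (LInf lP) => e e0; have [N HN] := half_small 2 e0.
exists N => n Nn; rewrite rnorm_linf; apply: le_trans (HN n Nn).
apply: linf_rnorm_le => [|i]; last exact: dl.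
by rewrite mulr_ge0// exprn_ge0// invr_ge0.
Qed.

HB.instance Definition _ :=
  Uniform_isComplete.Build linf (rapid_complete linf_rapid).

Section Ultraproduct.
Variables (U : set_system I) (FU : UltraFilter U).

Definition null_set : set linf :=
  [set x | (rnorm (lval x i) @[i --> U]) --> (0 : R)].

Lemma null_setP x : null_set x <->
  forall e : R, 0 < e -> \forall i \near U, rnorm (lval x i) <= e.
Proof.
rewrite /null_set /=; split.
  move=> /cvgrPdist_le H e /H; apply: filterS => i.
  by rewrite sub0r normrN ger0_norm// rnorm_ge0.
move=> H; apply/cvgrPdist_le => /= e /H; apply: filterS => i.
by rewrite sub0r normrN ger0_norm// rnorm_ge0.
Qed.

Fact null_set0 : null_set 0.
Proof. by apply/null_setP => e e0; apply: nearW => i /=; rewrite rnorm0 ltW. Qed.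

Fact null_set_linear (a : K) (x y : linf) :
  null_set x -> null_set y -> null_set (a *: x + y).
Proof.
have a0 : 0 <= res `|a| by exact: (@rnorm_ge0 _ _ (scalar_space R s) a).
move=> /null_setP xN /null_setP yN; apply/null_setP => e e0.
have e1 : 0 < e / (res `|a| + 1) by rewrite divr_gt0// ltr_wpDl.
near=> i.
have h1 : rnorm (lval x i) <= e / (res `|a| + 1) by near: i; exact: xN.
have h2 : rnorm (lval y i) <= e / (res `|a| + 1) by near: i; exact: yN.
apply: le_trans (rnormD _ _) _; rewrite rnormZ.
apply: le_trans (lerD (ler_wpM2l a0 h1) h2) _.
by rewrite -[X in _ + X]mul1r -mulrDl mulrCA mulfV ?mulr1// gt_eqF// ltr_wpDl.
Unshelve. all: by end_near. Qed.

Fact null_set_closed : closed null_set.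
Proof.
move=> x clx; apply/null_setP => e e0.
have e2 : 0 < e / 2 by rewrite divr_gt0.
have [y [/null_setP yN xy]] := clx _ (nbhsx_ballx x _ (emb_gt0 s e2)).
have {}xy : rnorm (x - y) < e / 2.
  by move: xy; rewrite -ball_normE /= -emb_rnorm lt_emb.
apply: filterS (yN _ e2) => i hy.
have := rnorm_lval (x - y) i; have := rnorm_tri (lval x i) 0 (lval y i).
have := rnormD (lval x i - lval y i) (lval y i); rewrite subrK /=; lra.
Qed.

Definition null_subspace : closed_subspace linf :=
  ClosedSubspace null_set0 null_set_linear null_set_closed.

Definition ultraproduct : completeNormedModType K := quotient_type null_subspace.

(* The class (x_i)_U of a bounded family; unbounded families go to 0. *)
Definition ultra_class (x : forall i, X i) : ultraproduct :=
  match pselect (bounded_family x) with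
  | left xb => qmap null_subspace (LInf xb)
  | right _ => 0
  end.

Lemma ultra_classE (x : linf) : ultra_class (lval x) = qmap null_subspace x.
Proof.
rewrite /ultra_class; case: pselect => [xb|/(_ (lvalP x))//].
by congr qmap; apply: linf_ext.
Qed.

Definition ultra_repr (q : ultraproduct) : forall i, X i :=
  lval (repr (q : Quotient.quot (sub_pred null_subspace : zmodClosed linf))).

Lemma ultra_reprK q : ultra_class (ultra_repr q) = q.
Proof. by rewrite ultra_classE /qmap reprK. Qed.

Lemma ultra_class_eq (x y : forall i, X i) :
  bounded_family x -> bounded_family y ->
  (ultra_class x = ultra_class y) <->
  ((rnorm (x i - y i) @[i --> U]) --> (0 : R)).
Proof.
move=> xb yb; have := ultra_classE (LInf xb); have := ultra_classE (LInf yb).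
by move=> /= -> ->; apply: qmapE.
Qed.

End Ultraproduct.
End LInfinity.

Section UltraproductOperator.
Variables (R : realType) (s : scalars).
Local Notation K := (scalarK R s).
Variables (I : Type) (X Y : I -> completeNormedModType K).
Variables (U : set_system I) (FU : UltraFilter U).

(* (T_i)_U maps (x_i)_U to (T_i x_i)_U; see ultra_operatorE. *)
Definition ultra_operator (T : forall i, X i -> Y i)
    (q : ultraproduct X FU) : ultraproduct Y FU :=
  ultra_class FU (fun i => T i (ultra_repr q i)).

Lemma ultra_operatorE (T : forall i, X i -> Y i) (C : R)
    (x : forall i, X i) :
  (forall i, linear (T i)) -> (forall i x, rnorm (T i x) <= C * rnorm x) ->
  bounded_family x ->
  ultra_operator T (ultra_class FU x) = ultra_class FU (fun i => T i (x i)).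
Proof.
move=> Tl TC xb.
have bT y : bounded_family y -> bounded_family (fun i => T i (y i)).
  move=> [D yD]; exists (`|C| * D) => i; apply: le_trans (TC i _) _.
  apply: le_trans (ler_wpM2r (rnorm_ge0 _) (ler_norm C)) _.
  exact: ler_wpM2l.
have rb : bounded_family (ultra_repr (ultra_class FU x)) by exact: lvalP.
apply/ultra_class_eq; [exact: bT|exact: bT|].
have /ultra_class_eq : ultra_class FU (ultra_repr (ultra_class FU x))
  = ultra_class FU x by rewrite ultra_reprK.
move=> /(_ rb xb) H.
have TB i u v : T i (u - v) = T i u - T i v.
  by rewrite addrC -scaleN1r Tl scaleN1r addrC.
have {H}H : `|C| * rnorm (ultra_repr (ultra_class FU x) i - x i) @[i --> U] -->
  (`|C| * 0 : R) by exact: cvgMr.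
rewrite mulr0 in H.
apply: (squeeze_cvgr _ (cvg_cst 0) H).
apply: nearW => i; rewrite rnorm_ge0 -TB /=; apply: le_trans (TC i _) _.
by rewrite ler_wpM2r ?rnorm_ge0// ler_norm.
Qed.

End UltraproductOperator.

Notation banach R s := (completeNormedModType (scalarK R s)).

Section Operators.
Variables (R : realType) (s : scalars).
Local Notation K := (scalarK R s).

Definition bounded_operator (X Y : banach R s) (T : X -> Y) : Prop :=
  linear T /\ exists C : R, forall x, rnorm (T x) <= C * rnorm x.

Definition opnorm (X Y : banach R s) (T : X -> Y) : R :=
  sup [set rnorm (T x) | x in [set x | rnorm x <= 1]].

Definition finite_dimensional (X : banach R s) : Prop :=
  exists n (e : 'I_n -> X), forall x, exists c : 'I_n -> K,
    x = \sum_(i < n) c i *: e i.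

(* t is the trace of the finite-rank operator T : T = sum_i phi_i (x) y_i and
   t = sum_i phi_i(y_i) for some bounded functionals phi_i and vectors y_i. *)
Definition is_trace (Y : banach R s) (T : Y -> Y) (t : K) : Prop :=
  exists n (phi : 'I_n -> Y -> scalar_space R s) (y : 'I_n -> Y),
    [/\ forall i, bounded_operator (phi i),
        forall x, T x = \sum_(i < n) (phi i x : K) *: y i &
        t = \sum_(i < n) phi i (y i)].

(* The norm of H is induced by an inner product, which is linear in the first
   and conjugate-linear in the second variable. *)
Definition is_hilbert (H : banach R s) : Prop :=
  exists ip : {dot H for @conjs R s}, forall x : H, `|x| ^+ 2 = ip x x.

End Operators.

Section Ideals.
Variables (R : realType) (s : scalars).
Local Notation K := (scalarK R s).
Local Notation KK := (scalar_space R s : banach R s).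
Implicit Types X Y Z W : banach R s.

(* [qnorm A T] is only meaningful when [opmem A T]. *)
Record operator_class := OperatorClass {
  opmem : forall X Y, (X -> Y) -> Prop;
  qnorm : forall X Y, (X -> Y) -> R
}.

(* Quasi-Banach ideals in the sense of Pietsch; A(aT) = |a| A(T) and
   |T| <= A(T) follow from the axioms. *)
Record quasi_banach_ideal (A : operator_class) : Prop := QuasiBanachIdeal {
  ideal_bounded : forall X Y (T : X -> Y), opmem A T -> bounded_operator T;
  ideal_id : opmem A (@id KK);
  ideal_add : forall X Y (S T : X -> Y),
    opmem A S -> opmem A T -> opmem A (S \+ T);
  ideal_comp : forall W X Y Z (S : W -> X) (T : X -> Y) (Q : Y -> Z),
    bounded_operator S -> opmem A T -> bounded_operator Q ->
    opmem A (Q \o T \o S);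
  ideal_qnorm_ge0 : forall X Y (T : X -> Y), opmem A T -> 0 <= qnorm A T;
  ideal_qnorm_id : qnorm A (@id KK) = 1;
  ideal_qnorm_add : exists2 kappa : R, 1 <= kappa &
    forall X Y (S T : X -> Y), opmem A S -> opmem A T ->
      qnorm A (S \+ T) <= kappa * (qnorm A S + qnorm A T);
  ideal_qnorm_comp : forall W X Y Z (S : W -> X) (T : X -> Y) (Q : Y -> Z),
    bounded_operator S -> opmem A T -> bounded_operator Q ->
    qnorm A (Q \o T \o S) <= opnorm Q * qnorm A T * opnorm S;
  ideal_complete : forall X Y (T : nat -> X -> Y),
    (forall n, opmem A (T n)) ->
    (forall e : R, 0 < e -> exists N, forall m n, (N <= m)%N -> (N <= n)%N ->
      qnorm A (T m \- T n) <= e) ->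
    exists2 L : X -> Y, opmem A L &
      forall e : R, 0 < e -> exists N, forall n, (N <= n)%N ->
        qnorm A (T n \- L) <= e
}.

(* The quasi-norm of A is a norm on every component of A. *)
Definition one_banach (A : operator_class) : Prop :=
  forall X Y,
    [/\ forall T : X -> Y, opmem A T -> qnorm A T = 0 -> forall x, T x = 0,
        forall (a : K) (T : X -> Y), opmem A T ->
          qnorm A (fun x => a *: T x) = res `|a| * qnorm A T &
        forall S T : X -> Y, opmem A S -> opmem A T ->
          qnorm A (S \+ T) <= qnorm A S + qnorm A T].

Definition class_le (A B : operator_class) : Prop :=
  forall X Y (T : X -> Y), opmem A T -> opmem B T.

Definition ideal_prod (A B : operator_class) : operator_class :=
  OperatorClass
    (fun X Y T => exists (Z : banach R s) (S : X -> Z) (Q : Z -> Y),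
       [/\ opmem B S, opmem A Q & T = Q \o S])
    (fun X Y T => inf [set r : R | exists (Z : banach R s) (S : X -> Z) (Q : Z -> Y),
       [/\ opmem B S, opmem A Q, T = Q \o S & r = qnorm A Q * qnorm B S]]).

Definition hilbert_factorable : operator_class :=
  OperatorClass
    (fun X Y T => exists (H : banach R s) (S : X -> H) (Q : H -> Y),
       [/\ is_hilbert H, bounded_operator S, bounded_operator Q & T = Q \o S])
    (fun X Y T => inf [set r : R | exists (H : banach R s) (S : X -> H) (Q : H -> Y),
       [/\ is_hilbert H, bounded_operator S, bounded_operator Q & T = Q \o S] /\
       r = opnorm Q * opnorm S]).

(* E is closed automatically, being finite-dimensional. *)
Definition adjoint_values (A : operator_class) X Y (T : X -> Y) : set R :=
  [set r : R | exists (E : closed_subspace X) (F : closed_subspace Y)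
      (S : quotient_type F -> subspace_type E) (t : K),
    [/\ finite_dimensional (subspace_type E : banach R s),
        finite_dimensional (quotient_type F : banach R s),
        [/\ bounded_operator S, opmem A S & qnorm A S <= 1],
        is_trace (T \o @subsp_incl R s X E \o S \o qmap F) t &
        r = res `|t|]].

Definition adjoint (A : operator_class) : operator_class :=
  OperatorClass
    (fun X Y T => bounded_operator T /\ has_ubound (adjoint_values A T))
    (fun X Y T => sup (adjoint_values A T)).

(* sup { sum_i |phi(x_i)| : phi in the unit ball of X' } *)
Definition weak_l1_norm X n (x : 'I_n -> X) : R :=
  sup [set \sum_(i < n) rnorm (phi (x i)) | phi in
        [set phi : X -> scalar_space R s |
           bounded_operator phi /\ opnorm phi <= 1]].

Definition summing_constants X Y (T : X -> Y) : set R :=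
  [set c : R | 0 <= c /\ forall n (x : 'I_n -> X),
    \sum_(i < n) rnorm (T (x i)) <= c * weak_l1_norm x].

Definition absolutely_summing : operator_class :=
  OperatorClass
    (fun X Y T => bounded_operator T /\ summing_constants T !=set0)
    (fun X Y T => inf (summing_constants T)).

Definition L_infty : operator_class := adjoint absolutely_summing.

Definition ultrastable (A : operator_class) : Prop :=
  forall (I : Type) (X Y : I -> banach R s) (T : forall i, X i -> Y i),
    (forall i, opmem A (T i)) ->
    has_ubound [set qnorm A (T i) | i in setT] ->
    forall (U : set_system I) (FU : UltraFilter U),
      opmem A (@ultra_operator R s I X Y U FU T) /\
      qnorm A (@ultra_operator R s I X Y U FU T) <=
        lim (qnorm A (T i) @[i --> U]).

Definition right_accessible (A : operator_class) : Prop :=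
  forall (E Y : banach R s) (T : E -> Y) (e : R),
    finite_dimensional E -> bounded_operator T -> 0 < e ->
    exists (F : closed_subspace Y) (S : E -> subspace_type F),
      [/\ finite_dimensional (subspace_type F : banach R s),
          bounded_operator S /\ opmem A S,
          T = @subsp_incl R s Y F \o S &
          qnorm A S <= (1 + e) * qnorm A T].

End Ideals.

(* Main.v *)
Require Import Defs.
From HB Require Import structures.
From mathcomp Require Import all_boot all_order all_algebra.
From mathcomp Require Import all_classical all_reals all_analysis.
From mathcomp Require Import complex sesquilinear.
From mathcomp Require Import lra ring.

(** Suppose that A, the product of B with the operators that factor through a
    Hilbert space, carries a norm.  Let N >= 1 and n = N ^ 2, and let T be the
    identity of K ^ n regarded as an operator from l_infty^n to l_1^n.  It is a
    sum of n rank one operators of A-norm at most 1, so the triangle inequality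
    gives A(T) <= n ([qnorm_coord_sum]).  Hence T = Q S with
    S : l_infty^n -> H, Q in B(H, l_1^n), H a Hilbert space, and
    B(Q) |S| <= 2 n.  It turns out that Q has a large norm in L_infty.

    Averaging |S (sum_i +-e_i)| ^ 2 over all signs and using the parallelogram
    law gives sum_i |S e_i| ^ 2 <= |S| ^ 2.  Orthonormalize S e_1, ..., S e_n to
    h_1, ..., h_n by the Gram-Schmidt process.  Since Q S = id, the i-th
    coordinate of Q h_i is the reciprocal of the distance of S e_i to the span
    of its predecessors, hence at least 1 / |S e_i| ([gram_schmidt]).  Therefore
    sum_i (Q h_i)_i >= sum_i 1 / |S e_i| >= n N / |S|  ([sum_inv_ge]).

    The left side is the trace of Q V, where V : l_1^n -> H maps e_i to h_i.
    By orthonormality |V y| is the Euclidean norm of y, so the Khinchine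
    inequality bounds it by twice the average of |sum_i +-y_i|, an average of
    norm one functionals; thus V is absolutely 1-summing with constant at most
    2 ([khinchine]), and trace duality bounds |tr(Q V)| by 2 P_1^*(Q)
    ([trace_bound]).

    Finally P_1^* is controlled by B: since B is contained in L_infty, there is
    c with |tr(Q V)| <= c B(Q) for all these test operators ([test_le_qnorm]).
    This is a gliding hump argument: operators T_k of rapidly decreasing B-norm
    and increasing test values could be summed, by completeness of B, to one
    block diagonal operator of B between l_infty sums, which then would not
    lie in L_infty.  Altogether n N <= |S| c B(Q) <= 2 c n, that is N <= 2 c for
    every N, which is absurd. *)

Set Implicit Arguments.
Unset Strict Implicit.
Unset Printing Implicit Defensive.

Import Order.TTheory GRing.Theory Num.Theory.
Import numFieldNormedType.Exports.

Local Open Scope classical_set_scope.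
Local Open Scope ring_scope.

(** * Bounded operators *)

Section BoundedOperators.
Variables (R : realType) (s : scalars).
Local Notation K := (scalarK R s).
Local Notation KK := (scalar_space R s : banach R s).
Implicit Types X Y Z : banach R s.

Lemma linear_add X Y (T : X -> Y) : linear T -> forall x y, T (x + y) = T x + T y.
Proof. by move=> lT x y; have := lT 1 x y; rewrite !scale1r. Qed.

Lemma linear_zero X Y (T : X -> Y) : linear T -> T 0 = 0.
Proof.
by move=> lT; apply: (addIr (T 0)); rewrite -(linear_add lT) !add0r.
Qed.

Lemma linear_scale X Y (T : X -> Y) : linear T -> forall a x, T (a *: x) = a *: T x.
Proof. by move=> lT a x; have := lT a x 0; rewrite (linear_zero lT) !addr0. Qed.

Lemma linear_sub X Y (T : X -> Y) : linear T -> forall x y, T (x - y) = T x - T y.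
Proof.
by move=> lT x y; rewrite -scaleN1r (linear_add lT) (linear_scale lT) scaleN1r.
Qed.

Lemma linear_sum_ord X Y (T : X -> Y) : linear T -> forall n (F : 'I_n -> X),
  T (\sum_(i < n) F i) = \sum_(i < n) T (F i).
Proof.
move=> lT; elim=> [|n IH] F; first by rewrite !big_ord0 (linear_zero lT).
by rewrite !big_ord_recl (linear_add lT) IH.
Qed.

Lemma rnorm_sum_ord X n (F : 'I_n -> X) :
  rnorm (\sum_(i < n) F i) <= \sum_(i < n) rnorm (F i).
Proof.
elim: n F => [|n IH] F; first by rewrite !big_ord0 rnorm0.
by rewrite !big_ord_recl (le_trans (rnormD _ _))// lerD2l.
Qed.

Lemma res_norm_ge0 (a : K) : 0 <= res `|a|.
Proof. exact: (@rnorm_ge0 _ _ KK a). Qed.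

Lemma res_norm_emb (t : R) : 0 <= t -> res `|emb t : K| = t.
Proof. by move=> t0; rewrite ger0_norm ?embK// emb_ge0. Qed.

Lemma res_normM (a b : K) : res `|a * b| = res `|a| * res `|b|.
Proof. exact: (@rnormZ _ _ KK a b). Qed.

Lemma bounded_bound X Y (T : X -> Y) : bounded_operator T ->
  exists2 C, 0 <= C & forall x, rnorm (T x) <= C * rnorm x.
Proof.
move=> [_ [C TC]]; exists `|C| => // x; apply: le_trans (TC x) _.
by rewrite ler_wpM2r ?rnorm_ge0// ler_norm.
Qed.

Lemma opnorm_ge0 X Y (T : X -> Y) : 0 <= opnorm T.
Proof.
rewrite /opnorm; set A := [set _ | _ in _].
have [bA|nA] := pselect (has_ubound A).
  apply: le_trans (rnorm_ge0 (T 0)) _; apply: ub_le_sup => //.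
  by exists 0 => //=; rewrite rnorm0.
by rewrite sup_out// => -[].
Qed.

Lemma opnorm_le X Y (T : X -> Y) (C : R) : 0 <= C ->
  (forall x, rnorm (T x) <= C * rnorm x) -> opnorm T <= C.
Proof.
move=> C0 TC; apply: ge_sup.
  by exists (rnorm (T 0)); exists 0 => //=; rewrite rnorm0.
move=> _ [x /= x1 <-]; apply: le_trans (TC x) _.
by rewrite -[leRHS]mulr1 ler_wpM2l.
Qed.

Lemma opnormP X Y (T : X -> Y) : bounded_operator T ->
  forall x, rnorm (T x) <= opnorm T * rnorm x.
Proof.
move=> bT x; have [C C0 TC] := bounded_bound bT.
have [x0|x0] := eqVneq (rnorm x) 0.
  by rewrite x0 mulr0; have := TC x; rewrite x0 mulr0.
have {}x0 : 0 < rnorm x by rewrite lt_def x0 rnorm_ge0.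
have xi0 : 0 <= (rnorm x)^-1 by rewrite invr_ge0 ltW.
rewrite -ler_pdivrMr// mulrC -(@res_norm_emb (rnorm x)^-1)//.
rewrite -rnormZ -(linear_scale bT.1).
apply: ub_le_sup.
  exists C => _ [y /= y1 <-]; apply: le_trans (TC y) _.
  by rewrite -[leRHS]mulr1 ler_wpM2l.
exists (emb (rnorm x)^-1 *: x) => //=.
by rewrite rnormZ res_norm_emb// mulVf ?gt_eqF.
Qed.

Lemma bounded_id X : bounded_operator (@id X).
Proof. by split=> [//|]; exists 1 => x; rewrite mul1r. Qed.

Lemma opnorm_id X : opnorm (@id X) <= 1.
Proof. by apply: opnorm_le => // x; rewrite mul1r. Qed.

Lemma bounded_comp X Y Z (S : X -> Y) (T : Y -> Z) :
  bounded_operator S -> bounded_operator T -> bounded_operator (T \o S).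
Proof.
move=> bS bT; split=> [a x y|]; first by rewrite /= bS.1 bT.1.
exists (opnorm T * opnorm S) => x /=; apply: le_trans (opnormP bT _) _.
by rewrite -mulrA ler_wpM2l ?opnorm_ge0// opnormP.
Qed.

Lemma bounded_scale X Y (a : K) (T : X -> Y) : bounded_operator T ->
  bounded_operator (fun x => a *: T x).
Proof.
move=> bT; split=> [b x y|]; first by rewrite bT.1 scalerDr !scalerA mulrC.
exists (res `|a| * opnorm T) => x; rewrite rnormZ -mulrA.
by rewrite ler_wpM2l ?res_norm_ge0// opnormP.
Qed.

Lemma bounded_scale_id X (a : K) : bounded_operator (fun x : X => a *: x).
Proof. exact: (bounded_scale a (bounded_id X)). Qed.

Lemma opnorm_scale_id X (a : K) : opnorm (fun x : X => a *: x) <= res `|a|.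
Proof. by apply: opnorm_le; rewrite ?res_norm_ge0// => x; rewrite rnormZ. Qed.

Lemma bounded_line X (x : X) : bounded_operator (fun t : KK => (t : K) *: x).
Proof.
split=> [a u v|]; first by rewrite scalerDl scalerA.
by exists (rnorm x) => t; rewrite rnormZ mulrC.
Qed.

Lemma opnorm_line X (x : X) : opnorm (fun t : KK => (t : K) *: x) <= rnorm x.
Proof. by apply: opnorm_le; rewrite ?rnorm_ge0// => t; rewrite rnormZ mulrC. Qed.

Lemma bounded_sum X Y n (T : 'I_n -> X -> Y) :
  (forall i, bounded_operator (T i)) ->
  bounded_operator (fun x => \sum_(i < n) T i x).
Proof.
move=> bT; split=> [a x y|].
  by rewrite scaler_sumr -big_split; apply: eq_bigr => i _; rewrite (bT i).1.
exists (\sum_(i < n) opnorm (T i)) => x; rewrite mulr_suml.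
by apply: le_trans (rnorm_sum_ord _) _; apply: ler_sum => i _; exact: opnormP.
Qed.

End BoundedOperators.

(** * Averages over signs and the Khinchine inequality *)

Section SignAverages.
Variables (R : realType) (s : scalars).
Local Notation K := (scalarK R s).

(** Recursion on the number of signs, rather than a sum over all patterns, turns
    moment computations into one application of the parallelogram law per
    coordinate. *)
Fixpoint sign_avg n (F : seq bool -> R) : R :=
  if n is m.+1 then
    (sign_avg m (fun e => F (true :: e)) + sign_avg m (fun e => F (false :: e))) / 2
  else F [::].

Lemma sign_avg_le n F G : (forall e, F e <= G e) -> sign_avg n F <= sign_avg n G.
Proof.
elim: n F G => [|n IH] F G FG /=; first exact: FG.
have := IH (fun e => F (true :: e)) (fun e => G (true :: e)) (fun e => FG _).
have := IH (fun e => F (false :: e)) (fun e => G (false :: e)) (fun e => FG _).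
lra.
Qed.

Lemma eq_sign_avg n F G : (forall e, F e = G e) -> sign_avg n F = sign_avg n G.
Proof. by move=> FG; congr sign_avg; apply/funext. Qed.

Lemma sign_avgD n F G :
  sign_avg n (fun e => F e + G e) = sign_avg n F + sign_avg n G.
Proof.
by elim: n F G => [|n IH] F G //=; rewrite !IH; lra.
Qed.

Lemma sign_avgZ n c F : sign_avg n (fun e => c * F e) = c * sign_avg n F.
Proof. by elim: n F => [|n IH] F //=; rewrite !IH; lra. Qed.

Lemma sign_avg_cst n c : sign_avg n (fun=> c) = c.
Proof. by elim: n => [|n IH] //=; rewrite IH; lra. Qed.

Lemma sign_avg_sum n m (F : 'I_m -> seq bool -> R) :
  \sum_(k < m) sign_avg n (F k) = sign_avg n (fun e => \sum_(k < m) F k e).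
Proof.
elim: m F => [|m IH] F.
  by rewrite big_ord0 -[LHS](sign_avg_cst n); apply: eq_sign_avg => e; rewrite big_ord0.
rewrite big_ord_recl IH -sign_avgD.
by apply: eq_sign_avg => e; rewrite big_ord_recl.
Qed.

Definition signed_sum (X : banach R s) n (a : 'I_n -> X) (e : seq bool) : X :=
  \sum_(i < n) (-1) ^+ nth false e i *: a i.

Lemma signed_sumS (X : banach R s) n (a : 'I_n.+1 -> X) b e :
  signed_sum a (b :: e) =
  signed_sum (fun i => a (lift ord0 i)) e + (-1) ^+ b *: a ord0.
Proof. by rewrite /signed_sum big_ord_recl addrC. Qed.

Lemma sign_avgS (X : banach R s) n (a : 'I_n.+1 -> X) (g : X -> R) :
  sign_avg n.+1 (fun e => g (signed_sum a e)) =
  sign_avg n (fun e =>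
    (g (signed_sum (fun i => a (lift ord0 i)) e - a ord0) +
     g (signed_sum (fun i => a (lift ord0 i)) e + a ord0)) / 2).
Proof.
rewrite /= -sign_avgD mulrC -sign_avgZ; apply: eq_sign_avg => e.
by rewrite !signed_sumS /= expr1 expr0 scaleN1r scale1r; lra.
Qed.

Definition parallelogram_law (X : banach R s) : Prop := forall x y : X,
  rnorm (x + y) ^+ 2 + rnorm (x - y) ^+ 2 = 2 * (rnorm x ^+ 2 + rnorm y ^+ 2).

Section Parallelogram.
Variables (X : banach R s) (pX : parallelogram_law X).

Lemma sign_avg_square n (a : 'I_n -> X) :
  sign_avg n (fun e => rnorm (signed_sum a e) ^+ 2) =
  \sum_(i < n) rnorm (a i) ^+ 2.
Proof.
elim: n a => [|n IH] a; first by rewrite /= /signed_sum !big_ord0 rnorm0 expr0n.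
rewrite (sign_avgS a (fun x => rnorm x ^+ 2)) big_ord_recl -IH.
rewrite -[X in X + _](sign_avg_cst n) -sign_avgD; apply: eq_sign_avg => e.
have := pX (signed_sum (fun i => a (lift ord0 i)) e) (a ord0); lra.
Qed.

(** In a Hilbert space this is (Re (x, y)) ^ 2 <= |x| ^ 2 |y| ^ 2.  The
    parallelogram law fixes |x + y| ^ 2 + |x - y| ^ 2, and the triangle
    inequality bounds the difference of |x + y| and |x - y| by 2 |x| and 2 |y|;
    together these control |x + y| ^ 4 + |x - y| ^ 4. *)
Lemma parallelogram_fourth (x y : X) :
  (rnorm (x - y) ^+ 4 + rnorm (x + y) ^+ 4) / 2 <=
  rnorm x ^+ 4 + 6 * (rnorm x ^+ 2 * rnorm y ^+ 2) + rnorm y ^+ 4.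
Proof.

have h1 := pX x y.
have tri (z w : X) : rnorm (z + w) <= rnorm (z - w) + 2 * rnorm w.
  have -> : z + w = (z - w) + (w + w) by rewrite addrA subrK.
  by apply: le_trans (rnormD _ _) _; rewrite lerD2l mulrC mulr_natr mulr2n rnormD.
have h2 := tri x y.
have h3 := tri y x.
have h4 := tri x (- y).
have h5 := tri y (- x).
rewrite opprK in h4; rewrite opprK in h5.
rewrite (addrC y x) in h3 h5; rewrite -(rnormC x y) in h3 h5.
rewrite rnormN in h4; rewrite rnormN in h5.
move: h1 h2 h3 h4 h5; move: (rnorm_ge0 x) (rnorm_ge0 y).
move: (rnorm x) (rnorm y) (rnorm (x + y)) (rnorm (x - y)) => p q u v.
move=> p0 q0 h1 h2 h3 h4 h5.
have d1 : 0 <= 4 * p ^+ 2 - (u - v) ^+ 2.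
  have -> : 4 * p ^+ 2 - (u - v) ^+ 2 = (2 * p - u + v) * (2 * p + u - v) by ring.
  by apply: mulr_ge0; lra.
have d2 : 0 <= 4 * q ^+ 2 - (u - v) ^+ 2.
  have -> : 4 * q ^+ 2 - (u - v) ^+ 2 = (2 * q - u + v) * (2 * q + u - v) by ring.
  by apply: mulr_ge0; lra.
have h6 := mulr_ge0 d1 d2.
(* With d = (u - v) ^ 2, (u ^ 2 - v ^ 2) ^ 2 = d (4 (p ^ 2 + q ^ 2) - d), and
   h6 says that this is at most 16 p ^ 2 q ^ 2. *)
have h7 : (u ^+ 2 - v ^+ 2) ^+ 2 =
    (u - v) ^+ 2 * (2 * (u ^+ 2 + v ^+ 2) - (u - v) ^+ 2).
  by ring.
have h8 : v ^+ 4 + u ^+ 4 = ((u ^+ 2 + v ^+ 2) ^+ 2 + (u ^+ 2 - v ^+ 2) ^+ 2) / 2.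
  by field.
rewrite h8 h7 h1; lra.
Qed.

Lemma sign_avg_fourth n (a : 'I_n -> X) :
  sign_avg n (fun e => rnorm (signed_sum a e) ^+ 4) <=
  3 * (\sum_(i < n) rnorm (a i) ^+ 2) ^+ 2.
Proof.
elim: n a => [|n IH] a.
  by rewrite /= /signed_sum !big_ord0 rnorm0 !expr0n mulr0.
pose f e := signed_sum (fun i => a (lift ord0 i)) e; pose q := rnorm (a ord0).
rewrite (sign_avgS a (fun x => rnorm x ^+ 4)) big_ord_recl.
have := @sign_avg_le n _ _ (fun e => parallelogram_fourth (f e) (a ord0)).
rewrite sign_avgD sign_avg_cst sign_avgD sign_avgZ.
rewrite (_ : sign_avg n (fun e => _ * rnorm (a ord0) ^+ 2) =
  rnorm (a ord0) ^+ 2 * sign_avg n (fun e => rnorm (f e) ^+ 2)); last first.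
  by rewrite -sign_avgZ; apply: eq_sign_avg => e; rewrite mulrC.
rewrite /f sign_avg_square => h1; have := IH (fun i => a (lift ord0 i)).
have := sqr_ge0 (rnorm (a ord0) ^+ 2).
move: h1; rewrite -/q.
move: (\sum_(i < n) _) (sign_avg _ _) (sign_avg _ _) => S A4 B4.
have -> : q ^+ 4 = (q ^+ 2) ^+ 2 by ring.
by move: (q ^+ 2) => r; lra.
Qed.

(** The second and fourth moments of t = |sum_i +-a_i| are l ^ 2 and at most
    3 l ^ 4, so a lower bound of t by a combination of t ^ 2 and t ^ 4 bounds the
    first moment below.  The one used is tangent at t = 2 l and gives
    l <= 16/9 E t. *)
Lemma khinchine n (a : 'I_n -> X) (l : R) : 0 <= l ->
  l ^+ 2 = \sum_(i < n) rnorm (a i) ^+ 2 ->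
  l <= 2 * sign_avg n (fun e => rnorm (signed_sum a e)).
Proof.
move=> l0 la; have [->|ln] := eqVneq l 0.
  apply: mulr_ge0 => //; rewrite -(sign_avg_cst n 0); apply: sign_avg_le => e.
  exact: rnorm_ge0.
have {ln}l0 : 0 < l by rewrite lt_def ln.
(* The difference of the two sides is t (t - 2 l) ^ 2 (t + 4 l). *)
have pt e : 12 * l ^+ 2 * rnorm (signed_sum a e) ^+ 2 +
    (-1) * rnorm (signed_sum a e) ^+ 4 <=
    16 * l ^+ 3 * rnorm (signed_sum a e).
  move: (rnorm_ge0 (signed_sum a e)); move: (rnorm _) => t t0.
  rewrite -subr_ge0.
  have -> : 16 * l ^+ 3 * t - (12 * l ^+ 2 * t ^+ 2 + (-1) * t ^+ 4) =
    t * ((t - 2 * l) ^+ 2 * (t + 4 * l)) by ring.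
  apply: mulr_ge0 => //; apply: mulr_ge0; first exact: sqr_ge0.
  by apply: addr_ge0 => //; apply: mulr_ge0 => //; exact: ltW.
have := sign_avg_le n pt.
rewrite sign_avgD !sign_avgZ sign_avg_square -la => h1.
have := sign_avg_fourth a; rewrite -la => h2.
have l3 : 0 < l ^+ 3 by rewrite exprn_gt0.
move: h1 h2; move: (sign_avg _ _) (sign_avg _ _) => A1 A4 h1 h2.
rewrite -(@ler_pM2l _ (l ^+ 3))//.
have e1 : l ^+ 3 * l = l ^+ 2 * l ^+ 2 by ring.
have : 0 <= (l ^+ 2) ^+ 2 by exact: sqr_ge0.
have e2 : l ^+ 3 * (2 * A1) = 2 * (l ^+ 3 * A1) by ring.
rewrite e1 e2; lra.
Qed.

End Parallelogram.
End SignAverages.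

(** * Finite-dimensional sequence spaces *)

Section SequenceNorms.
Variable R : realType.

(** Gauges on nonnegative n-tuples, squeezed between the maximum and the sum:
    the l_1 and the Euclidean norm share one construction of a Banach space. *)
Record seq_norm n := SeqNorm {
  seq_normf :> ('I_n -> R) -> R;
  seq_norm_le : forall a b : 'I_n -> R, (forall i, 0 <= a i <= b i) ->
    seq_normf a <= seq_normf b;
  seq_normD : forall a b : 'I_n -> R, (forall i, 0 <= a i) -> (forall i, 0 <= b i) ->
    seq_normf (fun i => a i + b i) <= seq_normf a + seq_normf b;
  seq_normZ : forall (c : R) (a : 'I_n -> R), 0 <= c ->
    seq_normf (fun i => c * a i) = c * seq_normf a;
  seq_norm_coord : forall (a : 'I_n -> R) i, (forall i, 0 <= a i) ->
    a i <= seq_normf a;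
  seq_norm_sum : forall a : 'I_n -> R, (forall i, 0 <= a i) ->
    seq_normf a <= \sum_(i < n) a i
}.

Lemma le_term_sum n (a : 'I_n -> R) i : (forall i, 0 <= a i) ->
  a i <= \sum_(i < n) a i.
Proof. by move=> a0; rewrite (bigD1 i)//= lerDl sumr_ge0. Qed.

Program Definition sum_norm n : seq_norm n :=
  @SeqNorm n (fun a => \sum_(i < n) a i) _ _ _ _ _.
Next Obligation. by move=> n a b ab; apply: ler_sum => i _; case/andP: (ab i). Qed.
Next Obligation. by move=> n a b _ _ /=; rewrite big_split. Qed.
Next Obligation. by move=> n c a _; rewrite /= mulr_sumr. Qed.
Next Obligation. by move=> n a i a0; exact: le_term_sum. Qed.
Next Obligation. by []. Qed.

Lemma cauchy_schwarz_sum n (a b : 'I_n -> R) :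
  \sum_(i < n) a i * b i <=
  Num.sqrt (\sum_(i < n) a i ^+ 2) * Num.sqrt (\sum_(i < n) b i ^+ 2).
Proof.
set A := \sum_(i < n) a i ^+ 2; set B := \sum_(i < n) b i ^+ 2.
have A0 : 0 <= A by apply: sumr_ge0 => i _; exact: sqr_ge0.
have B0 : 0 <= B by apply: sumr_ge0 => i _; exact: sqr_ge0.
have z (c : 'I_n -> R) : \sum_(i < n) c i ^+ 2 = 0 -> forall i, c i = 0.
  move=> c0 i; apply/eqP; rewrite -sqrf_eq0 eq_le sqr_ge0 andbT -c0.
  by apply: (@le_term_sum n (fun i => c i ^+ 2)) => j; exact: sqr_ge0.
have [A1|A1] := eqVneq A 0.
  rewrite big1 ?mulr_ge0 ?sqrtr_ge0// => i _.
  by rewrite (z _ A1) mul0r.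
have [B1|B1] := eqVneq B 0.
  rewrite big1 ?mulr_ge0 ?sqrtr_ge0// => i _.
  by rewrite (z _ B1) mulr0.
set p := Num.sqrt A; set q := Num.sqrt B.
have p0 : 0 < p by rewrite sqrtr_gt0 lt_def A1.
have q0 : 0 < q by rewrite sqrtr_gt0 lt_def B1.
have : 0 <= \sum_(i < n) (q * a i - p * b i) ^+ 2.
  by apply: sumr_ge0 => i _; exact: sqr_ge0.
rewrite (eq_bigr (fun i => q ^+ 2 * a i ^+ 2 + (p ^+ 2 * b i ^+ 2 +
  (- (2 * p * q)) * (a i * b i)))); last by move=> i _; ring.
rewrite !big_split /= -!mulr_sumr -/A -/B /q /p !sqr_sqrtr// -/p -/q.
move: (\sum_(i < n) _) => S h.
have h2 : 2 * (p * q) * S <= 2 * (p * q) * (p * q).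
  have -> : 2 * (p * q) * (p * q) = 2 * (p ^+ 2 * q ^+ 2) by ring.
  by rewrite !sqr_sqrtr//; lra.
by rewrite -(@ler_pM2l _ (2 * (p * q)))// !mulr_gt0.
Qed.

Program Definition euclidean_norm n : seq_norm n :=
  @SeqNorm n (fun a => Num.sqrt (\sum_(i < n) a i ^+ 2)) _ _ _ _ _.
Next Obligation.
move=> n a b ab; rewrite ler_wsqrtr//; apply: ler_sum => i _.
have /andP[a0 aib] := ab i.
by rewrite ler_sqr ?nnegrE// (le_trans a0).
Qed.
Next Obligation.
move=> n a b a0 b0 /=; set A := \sum_(i < n) a i ^+ 2; set B := \sum_(i < n) b i ^+ 2.
have p0 : 0 <= Num.sqrt A + Num.sqrt B by rewrite addr_ge0 ?sqrtr_ge0.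
rewrite -[leRHS](ger0_norm p0) -[leRHS]sqrtr_sqr ler_wsqrtr//.
rewrite sqrrD !sqr_sqrtr; try by apply: sumr_ge0 => i _; exact: sqr_ge0.
rewrite (eq_bigr (fun i => a i ^+ 2 + (2 * (a i * b i) + b i ^+ 2))); last first.
  by move=> i _; ring.
rewrite !big_split /= -mulr_sumr -/A -/B -addrA lerD2l lerD2r.
by rewrite -[X in _ <= X]mulr_natl ler_pM2l// cauchy_schwarz_sum.
Qed.
Next Obligation.
move=> n c a c0 /=.
rewrite (eq_bigr (fun i => c ^+ 2 * a i ^+ 2)); last by move=> i _; ring.
by rewrite -mulr_sumr sqrtrM ?sqr_ge0// sqrtr_sqr ger0_norm.
Qed.
Next Obligation.
move=> n a i a0; rewrite -[leLHS](ger0_norm (a0 i)) -sqrtr_sqr ler_wsqrtr//.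
by apply: (@le_term_sum n (fun i => a i ^+ 2)) => j; exact: sqr_ge0.
Qed.
Next Obligation.
move=> n a a0.
have S0 : 0 <= \sum_(i < n) a i by rewrite sumr_ge0.
rewrite -[leRHS](ger0_norm S0) -[leRHS]sqrtr_sqr ler_wsqrtr//.
rewrite [leRHS]expr2 mulr_suml; apply: ler_sum => i _.
by rewrite expr2 ler_wpM2l// le_term_sum.
Qed.

End SequenceNorms.

Section SequenceSpace.
Variables (R : realType) (s : scalars) (n : nat) (N : seq_norm R n).
Local Notation K := (scalarK R s).
Local Notation KK := (scalar_space R s : banach R s).

(** The [seq_norm] is a phantom argument: it selects the norm on the n-tuples. *)
Definition seq_space of seq_norm R n : Type := {ffun 'I_n -> K}.
Local Notation V := (seq_space N).

HB.instance Definition _ := GRing.Lmodule.on V.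

Definition coord (i : 'I_n) (x : V) : KK := (x : {ffun 'I_n -> K}) i.

Lemma coord_linear i : linear (coord i).
Proof. by move=> a x y; rewrite /coord !ffunE. Qed.

Definition seq_space_rnorm (x : V) : R := N (fun i => rnorm (coord i x)).
Definition seq_space_norm (x : V) : K := emb (seq_space_rnorm x).

Fact seq_space_normD x y :
  seq_space_norm (x + y) <= seq_space_norm x + seq_space_norm y.
Proof.
rewrite /seq_space_norm -embD le_emb.
apply: le_trans (seq_normD N (fun i => rnorm_ge0 _) (fun i => rnorm_ge0 _)).
apply: seq_norm_le => i; rewrite rnorm_ge0 /= /coord ffunE; exact: rnormD.
Qed.

Fact seq_space_normZ a x : seq_space_norm (a *: x) = `|a| * seq_space_norm x.
Proof.
rewrite /seq_space_norm -(resK (normr_ge0 a)) -embM; congr emb.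
rewrite /seq_space_rnorm -seq_normZ ?res_norm_ge0//; congr (seq_normf N _).
by apply/funext => i; rewrite /coord ffunE rnormZ.
Qed.

Fact seq_space_norm_eq0 x : seq_space_norm x = 0 -> x = 0.
Proof.
rewrite /seq_space_norm -(emb0 R s) => /(can_inj (@embK R s)) x0.
apply/ffunP => i; rewrite ffunE; apply: (@rnorm0_eq0 R s KK); apply/eqP.
rewrite eq_le rnorm_ge0 andbT -x0.
exact: (seq_norm_coord N i (fun j => rnorm_ge0 (coord j x))).
Qed.

HB.instance Definition _ := Lmodule_isNormed.Build K V
  seq_space_normD seq_space_normZ seq_space_norm_eq0.

Lemma rnorm_seq_space (x : V) : rnorm x = N (fun i => rnorm (coord i x)).
Proof. by rewrite /rnorm embK. Qed.

Lemma rnorm_coord (x : V) i : rnorm (coord i x) <= rnorm x.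
Proof.
rewrite rnorm_seq_space.
exact: (seq_norm_coord N i (fun j => rnorm_ge0 (coord j x))).
Qed.

Lemma rnorm_seq_space_le (x : V) : rnorm x <= \sum_(i < n) rnorm (coord i x).
Proof. by rewrite rnorm_seq_space; apply: seq_norm_sum => i; exact: rnorm_ge0. Qed.

Fact seq_space_rapid (u : nat -> V) : rapid 1 u -> exists l, cvg_seq u l.
Proof.
move=> ru.
have rui i : rapid 1 (fun m => coord i (u m)).
  move=> m; apply: le_trans (ru m); apply: le_trans (rnorm_coord _ i).
  by rewrite /coord !ffunE.
have L i : {l : KK | cvg_seq (fun m => coord i (u m)) l}.
  by apply: cid; exact: (complete_rapid ler01 (rui i)).
pose l i := projT1 (L i).
have Hl i : cvg_seq (fun m => coord i (u m)) (l i) := projT2 (L i).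
have dl m i : rnorm (coord i (u m) - l i) <= 2 * 2^-1 ^+ m.
  by have := rapid_cvg ler01 (rui i) (Hl i) m; rewrite mul1r.
exists ([ffun i => (l i : K)] : {ffun 'I_n -> K}) => e e0.
have [M HM] := half_small (n%:R * 2) e0.
exists M => m Mm; apply: le_trans (HM m Mm); apply: le_trans (rnorm_seq_space_le _) _.
rewrite -mulrA mulr_natl -[X in _ *+ X](card_ord n) -sumr_const; apply: ler_sum => i _.
by apply: le_trans (dl m i); rewrite /coord !ffunE.
Qed.

HB.instance Definition _ :=
  Uniform_isComplete.Build V (rapid_complete seq_space_rapid).

Definition basis_vector (i : 'I_n) : V :=
  [ffun j => if j == i then 1 else 0 : K].

Lemma coord_basis i j : coord i (basis_vector j) = if i == j then (1 : K) else 0.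
Proof. by rewrite /coord ffunE. Qed.

Lemma bounded_coord i : bounded_operator (coord i).
Proof.
split; first exact: coord_linear.
by exists 1 => x; rewrite mul1r rnorm_coord.
Qed.

Lemma rnorm_basis i : rnorm (basis_vector i) <= 1.
Proof.
apply: le_trans (rnorm_seq_space_le _) _.
rewrite (bigD1 i)//= big1 => [|j ji].
  by rewrite addr0 coord_basis eqxx /rnorm normr1 -(emb1 R s) embK.
by rewrite coord_basis (negPf ji) rnorm0.
Qed.

End SequenceSpace.

(** * Inner products *)

Section Conjugation.
Variables (R : realType) (s : scalars).
Local Notation K := (scalarK R s).
Implicit Types a b : K.

Lemma conjsD a b : conjs (a + b) = conjs a + conjs b.
Proof. by move: a b; rewrite /conjs; case: s => //= a b; rewrite rmorphD. Qed.

Lemma conjsM a b : conjs (a * b) = conjs a * conjs b.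
Proof. by move: a b; rewrite /conjs; case: s => //= a b; rewrite rmorphM. Qed.

Lemma conjsK a : conjs (conjs a) = a.
Proof. by move: a; rewrite /conjs; case: s => //= a; exact: conjcK. Qed.

Lemma conjs_emb (t : R) : conjs (emb t : K) = emb t.
Proof. by rewrite /conjs /emb; case: s => //=; exact: conjc_real. Qed.

Lemma conjs0 : conjs (0 : K) = 0.
Proof. by rewrite -(emb0 R s) conjs_emb. Qed.

Lemma mul_conjs a : a * conjs a = emb (res `|a| ^+ 2).
Proof.
move: a; rewrite /conjs /emb /res; case: s => /= a.
  by rewrite real_normK ?num_real// expr2.
case: a => x y /=; rewrite sqr_sqrtr ?addr_ge0 ?sqr_ge0//.
by apply/eqP; rewrite eq_complex /=; apply/andP; split; apply/eqP; ring.
Qed.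

Lemma emb_sum n (F : 'I_n -> R) :
  emb (\sum_(i < n) F i) = \sum_(i < n) emb (F i) :> K.
Proof. by elim/big_ind2: _ => [|? ? ? ? <- <-|//]; rewrite ?emb0 ?embD. Qed.

End Conjugation.

Section InnerProduct.
Variables (R : realType) (s : scalars).
Local Notation K := (scalarK R s).
Local Notation KK := (scalar_space R s : banach R s).

Definition inner_product (H : banach R s) (ip : H -> H -> K) : Prop :=
  [/\ forall (a : K) x y z, ip (a *: x + y) z = a * ip x z + ip y z,
      forall x y, ip y x = conjs (ip x y) &
      forall x, ip x x = emb (rnorm x ^+ 2)].

Lemma hilbert_inner_product (H : banach R s) : is_hilbert H ->
  exists ip : H -> H -> K, inner_product ip.
Proof.
move=> [f fH]; exists f; split=> [a x y z|x y|x].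
- by rewrite (linearDl f) (linearZl_LR f).
- by have := @hermitian_subproof _ _ _ _ f y x; rewrite expr0 mul1r.
by rewrite -fH -emb_rnorm expr2 -embM -expr2.
Qed.

Lemma scalar_inner_product : inner_product (fun x y : KK => (x : K) * conjs (y : K)).
Proof.
split=> [a x y z|x y|x]; first by rewrite mulrDl mulrA.
  by rewrite conjsM conjsK mulrC.
exact: mul_conjs.
Qed.

Section Theory.
Variables (H : banach R s) (ip : H -> H -> K) (ipP : inner_product ip).

Lemma ipC x y : ip y x = conjs (ip x y). Proof. by case: ipP. Qed.
Lemma ip_norm x : ip x x = emb (rnorm x ^+ 2). Proof. by case: ipP. Qed.
Lemma ipDl x y z : ip (x + y) z = ip x z + ip y z.
Proof. by case: ipP => h _ _; rewrite -[x]scale1r h mul1r scale1r. Qed.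
Lemma ip0l z : ip 0 z = 0.
Proof. by apply: (addIr (ip 0 z)); rewrite -ipDl !add0r. Qed.
Lemma ipZl a x z : ip (a *: x) z = a * ip x z.
Proof. by case: ipP => h _ _; have := h a x 0 z; rewrite ip0l !addr0. Qed.
Lemma ipNl x z : ip (- x) z = - ip x z.
Proof. by rewrite -scaleN1r ipZl mulN1r. Qed.
Lemma ipDr x y z : ip z (x + y) = ip z x + ip z y.
Proof. by rewrite ipC ipDl conjsD -!ipC. Qed.
Lemma ip0r z : ip z 0 = 0. Proof. by rewrite ipC ip0l conjs0. Qed.
Lemma ipNr x z : ip z (- x) = - ip z x.
Proof. by apply/eqP; rewrite -addr_eq0 -ipDr addNr ip0r. Qed.
Lemma ipZr a x z : ip z (a *: x) = conjs a * ip z x.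
Proof. by rewrite ipC ipZl conjsM -ipC. Qed.

Lemma ip_suml n (F : 'I_n -> H) z :
  ip (\sum_(i < n) F i) z = \sum_(i < n) ip (F i) z.
Proof. by elim/big_ind2: _ => [|? ? ? ? <- <-|//]; rewrite ?ip0l ?ipDl. Qed.

Lemma ip_pythagoras x y : ip x y = 0 ->
  rnorm (x + y) ^+ 2 = rnorm x ^+ 2 + rnorm y ^+ 2.
Proof.
move=> o; apply: (can_inj (@embK R s)); rewrite embD -!ip_norm.
by rewrite ipDl !ipDr o (ipC x y) o conjs0 addr0 add0r.
Qed.

Lemma inner_product_parallelogram : parallelogram_law H.
Proof.
move=> x y; apply: (can_inj (@embK R s)).
rewrite mulr_natl mulr2n !embD -!ip_norm.
by rewrite !(ipDl, ipDr, ipNl, ipNr); ring.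
Qed.

Definition orthonormal_family n (h : 'I_n -> H) : Prop :=
  forall i j, ip (h i) (h j) = if i == j then 1 else 0.

Lemma orthonormal_coef n (h : 'I_n -> H) (a : 'I_n -> K) i :
  orthonormal_family h -> ip (\sum_(j < n) a j *: h j) (h i) = a i.
Proof.
move=> oh; rewrite ip_suml (bigD1 i)//= big1 => [|j ji].
  by rewrite ipZl oh eqxx mulr1 addr0.
by rewrite ipZl oh (negPf ji) mulr0.
Qed.

Lemma orthonormal_pythagoras n (h : 'I_n -> H) (a : 'I_n -> K) :
  orthonormal_family h ->
  rnorm (\sum_(i < n) a i *: h i) ^+ 2 = \sum_(i < n) res `|a i| ^+ 2.
Proof.
move=> oh; apply: (can_inj (@embK R s)); rewrite -ip_norm emb_sum.
rewrite [LHS]ip_suml; apply: eq_bigr => i _.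
by rewrite ipZl ipC orthonormal_coef// mul_conjs.
Qed.

(** Pythagoras applied to x - P x and P x, for P the orthogonal projection onto
    the span of h. *)
Lemma bessel n (h : 'I_n -> H) (x : H) : orthonormal_family h ->
  rnorm (x - \sum_(i < n) ip x (h i) *: h i) <= rnorm x.
Proof.
move=> oh; set P := \sum_(i < n) _.
have o i : ip (x - P) (h i) = 0 by rewrite ipDl ipNl orthonormal_coef// subrr.
have oP : ip (x - P) P = 0.
  rewrite ipC ip_suml big1 ?conjs0// => i _.
  by rewrite ipZl (ipC (x - P)) o conjs0 mulr0.
have e := ip_pythagoras oP; rewrite subrK in e.
by rewrite -ler_sqr ?nnegrE ?rnorm_ge0// e lerDl sqr_ge0.
Qed.

(** Cauchy-Schwarz for a unit vector h. *)
Lemma ip_unit_le (x h : H) : ip h h = 1 -> res `|ip x h| <= rnorm x.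
Proof.
move=> h1; set P := ip x h *: h.
have o : ip (x - P) h = 0 by rewrite ipDl ipNl ipZl h1 mulr1 subrr.
have oP : ip (x - P) P = 0 by rewrite ipZr o mulr0.
have n1 : rnorm h ^+ 2 = 1 by rewrite -[LHS](@embK R s) -ip_norm h1 -(emb1 R s) embK.
have e : rnorm x ^+ 2 = rnorm (x - P) ^+ 2 + res `|ip x h| ^+ 2.
  rewrite -[X in _ + X]mulr1 -n1 -exprMn -rnormZ -(ip_pythagoras oP).
  by rewrite subrK.
by rewrite -ler_sqr ?nnegrE ?rnorm_ge0 ?res_norm_ge0// e lerDr sqr_ge0.
Qed.

Lemma bounded_ip (h : H) : ip h h = 1 ->
  bounded_operator (fun x => ip x h : KK).
Proof.
move=> h1; split=> [a x y|]; first by rewrite ipDl ipZl.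
by exists 1 => x; rewrite mul1r; exact: ip_unit_le.
Qed.

End Theory.

Section Euclidean.
Variable n : nat.
Local Notation V := (seq_space s (euclidean_norm R n)).

Definition euclidean_ip (x y : V) : K :=
  \sum_(i < n) (coord i x : K) * conjs (coord i y : K).

Fact euclidean_ip_linear a x y z :
  euclidean_ip (a *: x + y) z = a * euclidean_ip x z + euclidean_ip y z.
Proof.
rewrite /euclidean_ip mulr_sumr -big_split; apply: eq_bigr => i _ /=.
by rewrite (coord_linear i a x y) mulrDl mulrA.
Qed.

Fact euclidean_ipC x y : euclidean_ip x y = conjs (euclidean_ip y x).
Proof.
rewrite /euclidean_ip.
elim/big_ind2: _ => [|? ? ? ? -> ->|i _]; rewrite ?conjs0 ?conjsD//.
by rewrite conjsM conjsK mulrC.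
Qed.

Fact euclidean_ip_norm x : euclidean_ip x x = emb (rnorm x ^+ 2).
Proof.
rewrite rnorm_seq_space /= sqr_sqrtr; last by apply: sumr_ge0 => i _; exact: sqr_ge0.
by rewrite emb_sum; apply: eq_bigr => i _; exact: mul_conjs.
Qed.

Lemma euclidean_inner_product : inner_product euclidean_ip.
Proof.
split; [exact: euclidean_ip_linear| |exact: euclidean_ip_norm].
by move=> x y; exact: euclidean_ipC.
Qed.

Let ipP := euclidean_inner_product.

HB.instance Definition _ := isBilinear.Build K V V K *%R
  (conjs \; *%R) euclidean_ip
  (fun z x y => etrans (ipDl ipP x (- y) z) (congr1 _ (ipNl ipP y z)))
  (fun z x y => etrans (ipDr ipP x (- y) z) (congr1 _ (ipNr ipP y z)))
  (fun z a x => ipZl ipP a x z) (fun z a x => ipZr ipP a x z).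

HB.instance Definition _ := isHermitianSesquilinear.Build K V false
  conjs euclidean_ip (fun x y => etrans (ipC ipP y x) (esym (mul1r _))).

Fact euclidean_ip_gt0 (x : V) : x != 0 -> 0 < euclidean_ip x x.
Proof.
move=> x0; rewrite euclidean_ip_norm; apply: emb_gt0.
rewrite exprn_gt0// lt_def rnorm_ge0 andbT.
by apply: contra x0 => /eqP /rnorm0_eq0 ->.
Qed.

HB.instance Definition _ := isDotProduct.Build K V euclidean_ip euclidean_ip_gt0.

Lemma euclidean_hilbert : is_hilbert (V : banach R s).
Proof.
exists (euclidean_ip : {dot V for @conjs R s}) => x.
by rewrite /= euclidean_ip_norm -emb_rnorm expr2 -embM -expr2.
Qed.

End Euclidean.

End InnerProduct.

(** * Trace bounds for operators in L_infty *)

Section Subspaces.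
Variables (R : realType) (s : scalars).
Local Notation K := (scalarK R s).
Local Notation KK := (scalar_space R s : banach R s).
Implicit Types X Y Z : banach R s.

Lemma closed_kernel (I : Type) X Z (G : I -> X -> Z) :
  (forall i, bounded_operator (G i)) -> closed [set x | forall i, G i x = 0].
Proof.
move=> bG x clx i; apply: rnorm0_eq0; apply/eqP; rewrite eq_le rnorm_ge0 andbT.
apply/ler_addgt0Pr => e e0; rewrite add0r.
have c0 : 0 < opnorm (G i) + 1 by rewrite ltr_wpDl ?opnorm_ge0.
have d0 : 0 < e / (opnorm (G i) + 1) by rewrite divr_gt0.
have [y [yG xy]] := clx _ (nbhsx_ballx x _ (emb_gt0 s d0)).
have {}xy : rnorm (x - y) < e / (opnorm (G i) + 1).
  by move: xy; rewrite -ball_normE /= -emb_rnorm lt_emb.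
have -> : G i x = G i (x - y) by rewrite (linear_sub (bG i).1) yG subr0.
apply: le_trans (opnormP (bG i) _) _.
apply: le_trans (ler_wpM2l (opnorm_ge0 _) (ltW xy)) _.
rewrite mulrCA ger_pMr// ler_pdivrMr// mul1r lerDl//.
Qed.

Definition kernel_subspace (I : Type) X Z (G : I -> X -> Z)
  (bG : forall i, bounded_operator (G i)) : closed_subspace X :=
  @ClosedSubspace R s X [set x | forall i, G i x = 0]
    (fun i => linear_zero (bG i).1)
    (fun a x y Gx Gy i => etrans ((bG i).1 a x y)
      (etrans (congr2 (fun u v => a *: u + v) (Gx i) (Gy i))
        (etrans (addr0 _) (scaler0 _ a))))
    (closed_kernel bG).

(** The bound C passes to the quotient because every class has representatives
    of almost minimal norm. *)
Lemma quotient_factor Y Z (F : closed_subspace Y) (G : Y -> Z) :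
  bounded_operator G -> (forall y, carrier F y -> G y = 0) ->
  exists G' : quotient_type F -> Z,
    [/\ bounded_operator G', forall y, G' (qmap F y) = G y &
        forall C, 0 <= C -> (forall y, rnorm (G y) <= C * rnorm y) ->
          forall q, rnorm (G' q) <= C * rnorm q].
Proof.
move=> bG GF.
have [lift liftK] := choice (@qmap_surj R s Y F).
pose G' q := G (lift q).
have G'E y : G' (qmap F y) = G y.
  apply/eqP; rewrite -subr_eq0 -(linear_sub bG.1); apply/eqP; apply: GF.
  by apply/qmapE; rewrite liftK.
have G'C C : 0 <= C -> (forall y, rnorm (G y) <= C * rnorm y) ->
    forall q, rnorm (G' q) <= C * rnorm q.
  move=> C0 GC q; apply/ler_addgt0Pr => e e0.
  have c0 : 0 < C + 1 by rewrite ltr_wpDl.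
  have d0 : 0 < e / (C + 1) by rewrite divr_gt0.
  have [y <- hy] := quotient_rnorm_lt q d0.
  rewrite G'E; apply: le_trans (GC y) _; rewrite rnorm_quotient.
  apply: le_trans (ler_wpM2l C0 (ltW hy)) _; rewrite mulrDr lerD2l.
  by rewrite mulrCA ger_pMr// ler_pdivrMr// mul1r lerDl.
exists G'; split=> //; split; last first.
  by exists (opnorm G); apply: G'C; [exact: opnorm_ge0|exact: opnormP].
move=> a p q; have [x <-] := qmap_surj p; have [y <-] := qmap_surj q.
by rewrite -(@qmap_linear R s Y F a x y) !G'E bG.1.
Qed.

End Subspaces.

Section SummingSystems.
Variables (R : realType) (s : scalars).
Local Notation K := (scalarK R s).
Local Notation KK := (scalar_space R s : banach R s).
Implicit Types X Y Z : banach R s.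

(** What is required of V = sum_i phi_i (x) h_i for it to be used as a test
    operator in the definition of the adjoint ideal: the biorthogonal families
    make the span of h closed and the common kernel of phi of finite codimension,
    and the last two conditions say that V is absolutely 1-summing because |V y|
    is at most twice an average of functionals of norm at most 1. *)
Definition summing_system X Y n (h : 'I_n -> X) (phi : 'I_n -> Y -> KK) : Prop :=
  [/\ exists psi : 'I_n -> X -> KK, (forall i, bounded_operator (psi i)) /\
        forall i j, psi i (h j) = if i == j then (1 : K) else 0,
      exists y : 'I_n -> Y, forall i j, phi i (y j) = if i == j then (1 : K) else 0,
      forall i, bounded_operator (phi i),
      forall e y, rnorm (signed_sum (fun i => phi i y) e) <= rnorm y &
      forall a : 'I_n -> KK, rnorm (\sum_(i < n) (a i : K) *: h i) <=
        2 * sign_avg n (fun e => rnorm (signed_sum a e))].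

Lemma le_weak_l1_norm Y m (y : 'I_m -> Y) (f : Y -> KK) :
  bounded_operator f -> (forall y, rnorm (f y) <= rnorm y) ->
  \sum_(k < m) rnorm (f (y k)) <= weak_l1_norm y.
Proof.
move=> bf f1; apply: ub_le_sup.
  exists (\sum_(k < m) rnorm (y k)) => _ [g [bg g1] <-]; apply: ler_sum => k _.
  by apply: le_trans (opnormP bg _) _; rewrite ler_piMl ?rnorm_ge0.
by exists f => //; split=> //; apply: opnorm_le => // x; rewrite mul1r.
Qed.

(** V / 2 vanishes on F, the common kernel of the phi_i, and has values in E,
    the span of the h_i.  Hence it is induced by some S : Y / F -> E with
    P_1(S) <= 1, and the trace of T J_E S Q_F is half the left side. *)
Lemma trace_bound X Y n (h : 'I_n -> X) (phi : 'I_n -> Y -> KK) (T : X -> Y) M :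
  summing_system h phi -> bounded_operator T ->
  ubound (adjoint_values (absolutely_summing R s) T) M ->
  rnorm (\sum_(i < n) phi i (T (h i)) : KK) <= 2 * M.
Proof.
move=> [[psi [bpsi psih]] [y0 phiy] bphi phi1 hK] bT TM.
pose P x : X := \sum_(i < n) (psi i x : K) *: h i.
have bP : bounded_operator P.
  apply: bounded_sum => i; exact: (bounded_comp (bpsi i) (bounded_line (h i))).
have bG (_ : unit) : bounded_operator (fun x => x - P x).
  split=> [a x y|]; first by rewrite bP.1 scalerBr opprD addrACA.
  exists (1 + opnorm P) => x; apply: le_trans (rnormD _ _) _.
  by rewrite rnormN mulrDl mul1r lerD2l opnormP.
(* The span of h is the kernel of id - P, which shows that it is closed. *)
pose E := kernel_subspace bG; pose F := kernel_subspace bphi.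
pose V y : X := (2^-1 : K) *: \sum_(i < n) (phi i y : K) *: h i.
have bV : bounded_operator V.
  apply: bounded_scale; apply: bounded_sum => i.
  exact: (bounded_comp (bphi i) (bounded_line (h i))).
have hE i : h i \in sub_pred E.
  rewrite unfold_in inE /= => _; apply/eqP; rewrite subr_eq0 /P (bigD1 i)//=.
  rewrite psih eqxx scale1r big1 ?addr0// => j ji.
  by rewrite psih (negPf ji) scale0r.
have VE y : V y \in sub_pred E.
  by apply: rpredZ; apply: rpred_sum => i _; apply: rpredZ; exact: hE.
pose W y : subspace_type E := SubspaceElt (VE y).
have bW : bounded_operator W.
  split=> [a x y|]; first by apply: val_inj; rewrite /= bV.1.
  by exists (opnorm V) => y; exact: (opnormP bV).
have WF y : carrier F y -> W y = 0.
  move=> Fy; apply: val_inj; rewrite /= /V big1 ?scaler0// => i _.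
  by rewrite Fy scale0r.
have [S [bS SE _]] := quotient_factor bW WF.
have e2 : res `|2^-1 : K| = 2^-1.
  have n2 : (2 : K) != 0 by rewrite pnatr_eq0.
  have e2 : (2 : K) = emb 2 by rewrite -[LHS]/(1 + 1) -(emb1 R s) -embD.
  have -> : (2^-1 : K) = emb 2^-1.
    by apply: (mulfI n2); rewrite mulfV// e2 -embM mulfV ?emb1.
  by rewrite res_norm_emb// invr_ge0.
have Ssum m (q : 'I_m -> quotient_type F) :
    \sum_(k < m) rnorm (S (q k)) <=
      1 * weak_l1_norm (q : 'I_m -> (quotient_type F : banach R s)).
  have [y yq] := choice (fun k => qmap_surj (q k)).
  rewrite mul1r.
  have Sy k : rnorm (S (q k)) <=
      sign_avg n (fun e => rnorm (signed_sum (fun i => phi i (y k)) e)).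
    rewrite -yq SE -rnorm_incl /= /V rnormZ e2 ler_pdivrMl//; exact: hK.
  apply: le_trans (ler_sum _ (fun k _ => Sy k)) _.
  rewrite sign_avg_sum -[leRHS](sign_avg_cst n); apply: sign_avg_le => e.
  (* The signed sums of the phi_i vanish on F, so they are functionals of norm
     at most 1 on Y / F and compete in the weak l_1 norm there. *)
  pose f y := signed_sum (fun i => phi i y) e.
  have bf : bounded_operator f.
    by apply: bounded_sum => i; apply: bounded_scale; exact: bphi.
  have fF z : carrier F z -> f z = 0.
    by move=> Fz; rewrite /f /signed_sum big1// => i _; rewrite Fz scaler0.
  have [f' [bf' f'E f'C]] := quotient_factor bf fF.
  rewrite (eq_bigr (fun k => rnorm (f' (q k)))); last by move=> k _; rewrite -yq f'E.
  apply: le_weak_l1_norm => // p; rewrite -[leRHS]mul1r; apply: f'C => // z.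
  by rewrite mul1r; exact: phi1.
pose t : K := \sum_(i < n) (2^-1 * (phi i (T (h i)) : K)).
have tM : res `|t| <= M.
  apply: TM; exists E, F, S, t; split=> //.
  - exists n, (fun i => SubspaceElt (hE i)) => x; exists (fun i => psi i (subsp_incl x)).
    apply: val_inj; rewrite /= (linear_sum_ord (@incl_linear _ _ _ E)).
    have := subsp_inclP x; rewrite unfold_in inE /= => /(_ tt)/eqP.
    by rewrite subr_eq0 => /eqP {1}->; rewrite /P.
  - exists n, (fun i => qmap F (y0 i)) => q; have [y <-] := qmap_surj q.
    exists (fun i => phi i y).
    rewrite -(eq_bigr _ (fun i _ => linear_scale (@qmap_linear R s Y F) _ _)).
    rewrite -(linear_sum_ord (@qmap_linear R s Y F)); apply/qmapE => i.
    rewrite (linear_sub (bphi i).1) (linear_sum_ord (bphi i).1) (bigD1 i)//=.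
    rewrite (linear_scale (bphi i).1) phiy eqxx big1.
      by rewrite addr0 /GRing.scale/= mulr1 subrr.
    by move=> j ji; rewrite (linear_scale (bphi i).1) phiy eq_sym (negPf ji) scaler0.
  - split=> //; first by split=> //; exists 1; split.
    by apply: ge_inf; [exists 0 => c []|split].
  exists n, (fun i y => 2^-1 *: phi i y), (fun i => T (h i)); split.
  - by move=> i; exact: bounded_scale.
  - move=> y; rewrite /= SE /= /V (linear_scale bT.1) (linear_sum_ord bT.1).
    rewrite scaler_sumr; apply: eq_bigr => i _.
    by rewrite (linear_scale bT.1) scalerA.
  - by [].
move: tM; rewrite /t -mulr_sumr res_normM e2 ler_pdivrMl//.
Qed.

End SummingSystems.

(** * The Gram-Schmidt process *)

Section GramSchmidt.
Variables (R : realType) (s : scalars).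
Local Notation K := (scalarK R s).
Local Notation KK := (scalar_space R s : banach R s).
Variables (H : banach R s) (ip : H -> H -> K) (ipP : inner_product ip).

(** The functionals r_i are biorthogonal to v.  As h_i is the normalization of
    v_i minus a combination of h_0, ..., h_(i-1), on which r_i vanishes,
    r_i (h_i) is the reciprocal of a distance that is at most |v_i|. *)
Lemma gram_schmidt n (v : 'I_n -> H) (r : 'I_n -> H -> KK) :
  (forall i, linear (r i)) ->
  (forall i j, r i (v j) = if i == j then (1 : K) else 0) ->
  exists2 h : 'I_n -> H, orthonormal_family ip h &
    forall i, exists2 c : R, (rnorm (v i))^-1 <= c & r i (h i) = emb c.
Proof.
move=> lr rv.
(* After m steps the first m vectors are in place, and the functionals r_j
   vanish on the vectors before the j-th. *)
suff : forall m, (m <= n)%N -> exists h : 'I_n -> H,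
    [/\ forall i j : 'I_n, (i < m)%N -> (j < m)%N ->
          ip (h i) (h j) = if i == j then 1 else 0,
        forall i j : 'I_n, (i < m)%N -> (i < j)%N -> r j (h i) = 0 &
        forall i : 'I_n, (i < m)%N ->
          exists2 c : R, (rnorm (v i))^-1 <= c & r i (h i) = emb c].
  move=> /(_ n (leqnn n))[h [oh _ rh]]; exists h => [i j|i]; first exact: oh.
  exact: rh.
elim=> [_|m IH mn]; first by exists (fun=> 0); split=> i.
have [h [oh rh0 rh]] := IH (ltnW mn).
pose k := Ordinal mn.
pose g (i : 'I_m) := h (widen_ord (ltnW mn) i).
have og : orthonormal_family ip g by move=> i j; rewrite /g oh//=.
pose w := v k - \sum_(i < m) ip (v k) (g i) *: g i.
have rw : r k w = 1.
  rewrite /w (linear_sub (lr k)) (linear_sum_ord (lr k)) big1 ?subr0 ?rv ?eqxx//.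
  by move=> i _; rewrite (linear_scale (lr k)) rh0 ?scaler0/=.
have rw0 (j : 'I_n) : (k < j)%N -> r j w = 0.
  move=> kj; have jk : j == k = false by apply/negbTE; rewrite neq_ltn kj orbT.
  rewrite /w (linear_sub (lr j)) (linear_sum_ord (lr j)) big1 ?subr0 ?rv ?jk//.
  move=> i _; rewrite (linear_scale (lr j)) rh0 ?scaler0//=.
  by rewrite (ltn_trans _ kj)/=.
have wh (i : 'I_n) : (i < m)%N -> ip w (h i) = 0.
  move=> im; have -> : h i = g (Ordinal im) by congr h; apply: val_inj.
  by rewrite /w (ipDl ipP) (ipNl ipP) (orthonormal_coef ipP)// subrr.
have w0 : 0 < rnorm w.
  rewrite lt_def rnorm_ge0 andbT; apply/eqP => /rnorm0_eq0 we.
  by move: rw; rewrite we (linear_zero (lr k)) => /esym/eqP; rewrite oner_eq0.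
have wv : rnorm w <= rnorm (v k) by exact: bessel.
pose c := (rnorm w)^-1.
pose h' i := if i == k then emb c *: w else h i.
have hk : h' k = emb c *: w by rewrite /h' eqxx.
have hi (i : 'I_n) : (i < m)%N -> h' i = h i.
  by move=> im; rewrite /h'; case: eqP => // ik; rewrite ik ltnn in im.
have lem (i : 'I_n) : (i < m.+1)%N -> (i < m)%N \/ i = k.
  by rewrite ltnS leq_eqVlt => /orP[/eqP im|]; [right; apply: val_inj|left].
have kkE : ip (emb c *: w) (emb c *: w) = 1.
  rewrite (ipZl ipP) (ipZr ipP) conjs_emb (ip_norm ipP) -!embM -(emb1 R s).
  by congr emb; rewrite /c; field; rewrite gt_eqF.
exists h'; split.
- move=> i j /lem[im|->] /lem[jm|->]; rewrite ?hk ?hi//.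
  + exact: oh.
  + rewrite (ipC ipP) (ipZl ipP) wh// mulr0 conjs0.
    by case: eqP => // ik; rewrite ik ltnn in im.
  + rewrite (ipZl ipP) wh// mulr0.
    by case: eqP => // kj; rewrite -kj ltnn in jm.
  + by rewrite eqxx.
- move=> i j /lem[im|->] ij; first by rewrite hi// rh0.
  by rewrite hk (linear_scale (lr j)) rw0// scaler0.
move=> i /lem[im|->]; first by rewrite hi//; exact: rh.
rewrite hk (linear_scale (lr k)) rw; exists c; last exact: mulr1.
by rewrite lef_pV2 ?posrE// (lt_le_trans w0).
Qed.

End GramSchmidt.

(** * Sup-normed direct sums and operator ideals *)

Section SupSums.
Variables (R : realType) (s : scalars).
Local Notation K := (scalarK R s).
Local Notation KK := (scalar_space R s : banach R s).
Variables (I : eqType) (X : I -> banach R s).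
Local Notation LX := (linf X : banach R s).

Definition linf_proj k (x : LX) : X k := lval x k.

(** The type of the entry at i depends on i, whence the transport along k = i. *)
Definition single k (x : X k) i : X i :=
  if @eqP I k i is ReflectT e then ecast j (X j) e x else 0.

Lemma single_eq k (x : X k) : single x k = x.
Proof. by rewrite /single; case: eqP => // e; rewrite eq_axiomK. Qed.

Lemma single_neq k (x : X k) i : k != i -> single x i = 0.
Proof. by rewrite /single; case: eqP. Qed.

Fact single_bounded k (x : X k) : bounded_family (single x).
Proof.
exists (rnorm x) => i; have [<-|ki] := eqVneq k i; first by rewrite single_eq.
by rewrite single_neq// rnorm0 rnorm_ge0.
Qed.

Definition linf_inj k (x : X k) : LX := LInf (single_bounded x).

Lemma linf_injK k (x : X k) : linf_proj k (linf_inj x) = x.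
Proof. exact: single_eq. Qed.

Lemma bounded_linf_proj k : bounded_operator (linf_proj k).
Proof. by split=> //; exists 1 => x; rewrite mul1r; exact: rnorm_lval. Qed.

Lemma opnorm_linf_proj k : opnorm (linf_proj k) <= 1.
Proof. by apply: opnorm_le => // x; rewrite mul1r; exact: rnorm_lval. Qed.

Lemma rnorm_linf_inj k (x : X k) : rnorm (linf_inj x) = rnorm x.
Proof.
apply/eqP; rewrite eq_le; apply/andP; split.
  rewrite rnorm_linf; apply: linf_rnorm_le => [|i]; first exact: rnorm_ge0.
  have [<-|ki] := eqVneq k i; first by rewrite /= single_eq.
  by rewrite /= single_neq// rnorm0 rnorm_ge0.
by rewrite -[in leLHS](linf_injK x); exact: rnorm_lval.
Qed.

Lemma linf_inj_linear k : linear (@linf_inj k).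
Proof.
move=> a x y; apply: linf_ext => i /=.
by have [<-|ki] := eqVneq k i; rewrite ?single_eq// !single_neq// addr0 scaler0.
Qed.

Lemma bounded_linf_inj k : bounded_operator (@linf_inj k).
Proof.
split; first exact: linf_inj_linear.
by exists 1 => x; rewrite mul1r rnorm_linf_inj.
Qed.

Lemma opnorm_linf_inj k : opnorm (@linf_inj k) <= 1.
Proof. by apply: opnorm_le => // x; rewrite mul1r rnorm_linf_inj. Qed.

End SupSums.

Section Ideal.
Variables (R : realType) (s : scalars).
Local Notation K := (scalarK R s).
Local Notation KK := (scalar_space R s : banach R s).
Implicit Types W X Y Z : banach R s.
Variables (B : operator_class R s) (BI : quasi_banach_ideal B).

Lemma ideal_comp_le W X Y Z (S : W -> X) (T : X -> Y) (Q : Y -> Z) (a b : R) :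
  bounded_operator S -> opmem B T -> bounded_operator Q ->
  opnorm Q <= a -> opnorm S <= b ->
  opmem B (Q \o T \o S) /\ qnorm B (Q \o T \o S) <= a * qnorm B T * b.
Proof.
move=> bS TB bQ Qa Sb; split; first exact: (ideal_comp BI).
apply: le_trans (ideal_qnorm_comp BI bS TB bQ) _.
have T0 := ideal_qnorm_ge0 BI TB.
apply: ler_pM => //; rewrite ?mulr_ge0 ?opnorm_ge0//.
by apply: ler_pM => //; exact: opnorm_ge0.
Qed.

Lemma ideal_scale X Y (a : K) (T : X -> Y) : opmem B T ->
  opmem B (fun x => a *: T x) /\
  qnorm B (fun x => a *: T x) <= res `|a| * qnorm B T.
Proof.
move=> TB.
have [h1 h2] := ideal_comp_le (bounded_id X) TB (bounded_scale_id Y a)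
  (opnorm_scale_id Y a) (opnorm_id X).
by split=> //; move: h2; rewrite mulr1.
Qed.

Lemma ideal_rank_one X Y (f : X -> KK) (y : Y) : bounded_operator f ->
  opmem B (fun x => (f x : K) *: y) /\
  qnorm B (fun x => (f x : K) *: y) <= rnorm y * opnorm f.
Proof.
move=> bf.
have [h1 h2] := ideal_comp_le bf (ideal_id BI) (bounded_line y)
  (opnorm_line y) (lexx _).
by split=> //; move: h2; rewrite (ideal_qnorm_id BI) mulr1.
Qed.

Lemma ideal_zero X Y : opmem B (fun _ : X => 0 : Y) /\ qnorm B (fun _ : X => 0 : Y) = 0.
Proof.
have b0 : bounded_operator (fun _ : X => 0 : KK).
  by split=> [a x y|]; [rewrite scaler0 addr0|exists 0 => x; rewrite rnorm0 mul0r].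
have [] := ideal_rank_one (0 : Y) b0.
have -> : (fun _ : X => (0 : K) *: (0 : Y)) = (fun=> 0).
  by apply/funext => x; rewrite scaler0.
rewrite rnorm0 mul0r => h1 h2; split=> //.
by apply/eqP; rewrite eq_le h2 (ideal_qnorm_ge0 BI).
Qed.

(** Composing U with t |-> t x and with f yields the multiplication by the
    scalar f (U x) on K, whose quasi-norm is its modulus. *)
Lemma functional_le_qnorm X Y (U : X -> Y) (f : Y -> KK) (x : X) :
  opmem B U -> bounded_operator f ->
  rnorm (f (U x)) <= opnorm f * rnorm x * qnorm B U.
Proof.
move=> UB bf; set a := f (U x).
have [a0|a0] := eqVneq a 0.
  by rewrite a0 rnorm0 !mulr_ge0 ?opnorm_ge0 ?rnorm_ge0// (ideal_qnorm_ge0 BI).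
have [mB qB] := ideal_comp_le (bounded_line x) UB bf (lexx _) (opnorm_line x).
have bU := ideal_bounded BI UB.
have [_] := ideal_scale (a : K)^-1 mB.
rewrite (_ : (fun t => _) = (@id KK)); last first.
  apply/funext => t /=; rewrite (linear_scale bU.1) (linear_scale bf.1) -/a.
  by rewrite /GRing.scale /= mulrCA mulVf ?mulr1.
rewrite (ideal_qnorm_id BI) => h1.
have na : 0 < rnorm a.
  by rewrite lt_def rnorm_ge0 andbT; apply: contra a0 => /eqP /rnorm0_eq0 ->.
have e1 : res `|(a : K)^-1| * rnorm a = 1.
  have := @res_normM R s (a : K)^-1 (a : K).
  by rewrite mulVf// normr1 -(emb1 R s) embK.
have := ler_wpM2l (ltW na) h1; rewrite mulr1 mulrA [rnorm a * _]mulrC e1 mul1r.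
by move=> /le_trans; apply; rewrite mulrAC; apply: le_trans qB _; rewrite mulrAC.
Qed.

End Ideal.

(** * Gliding hump: the test values are dominated by the ideal quasi-norm *)

Section Gluing.
Variables (R : realType) (s : scalars).
Local Notation K := (scalarK R s).
Local Notation KK := (scalar_space R s : banach R s).
Variables (B : operator_class R s) (BI : quasi_banach_ideal B).

Section Blocks.
Variables (X Y : nat -> banach R s) (T : forall k, X k -> Y k).
Variable kappa : R.
Hypothesis kappa1 : 1 <= kappa.
Hypothesis kappaP : forall (V W : banach R s) (S S' : V -> W),
  opmem B S -> opmem B S' -> qnorm B (S \+ S') <= kappa * (qnorm B S + qnorm B S').
Hypothesis TB : forall k, opmem B (@T k).
Hypothesis Tk : forall k, qnorm B (@T k) <= (2 * kappa)^-1 ^+ k.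

Let LX : banach R s := linf X.
Let LY : banach R s := linf Y.
Let block (k : nat) (x : LX) : LY := @linf_inj _ _ _ Y k (T (linf_proj k x)).

Let blockP k : opmem B (block k) /\ qnorm B (block k) <= (2 * kappa)^-1 ^+ k.
Proof.
have [h1 h2] := ideal_comp_le BI (bounded_linf_proj X k) (TB k)
  (bounded_linf_inj Y k) (opnorm_linf_inj Y k) (opnorm_linf_proj X k).
by split=> //; apply: le_trans h2 _; rewrite mul1r mulr1.
Qed.

Let tail (l i : nat) (x : LX) : LY := \sum_(j < i) block (l + j)%N x.

(* Peeling off the first block costs a factor kappa, which the rate
   (2 kappa) ^ -k absorbs. *)
Let tailP i l : opmem B (tail l i) /\
  qnorm B (tail l i) <= 2 * kappa * (2 * kappa)^-1 ^+ l.
Proof.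
have k0 : 0 < 2 * kappa by move: kappa1; lra.
elim: i l => [|i IH] l.
  rewrite (_ : tail l 0 = fun=> 0); last by apply/funext => x; rewrite /tail big_ord0.
  have [h ->] := ideal_zero BI LX LY; split=> //.
  by rewrite mulr_ge0 ?exprn_ge0 ?invr_ge0// ltW.
have -> : tail l i.+1 = block l \+ tail l.+1 i.
  apply/funext => x; rewrite /tail big_ord_recl addn0 /=; congr (_ + _).
  by apply: eq_bigr => j _; rewrite /= addnS addSn.
have [b1 b2] := blockP l; have [t1 t2] := IH l.+1.
split; first exact: (ideal_add BI).
apply: le_trans (kappaP b1 t1) _.
apply: le_trans (ler_wpM2l _ (lerD b2 t2)) _; first by move: kappa1; lra.
rewrite exprS; move: (_ ^+ l) => p.
rewrite !mulrA mulfV ?gt_eqF// mul1r; lra.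
Qed.

Let sum_blocks m := tail 0 m.

Let sum_blocks_sub n m : (n <= m)%N ->
  opmem B (sum_blocks m \- sum_blocks n) /\
  qnorm B (sum_blocks m \- sum_blocks n) <= 2 * kappa * (2 * kappa)^-1 ^+ n.
Proof.
move=> nm; rewrite (_ : _ \- _ = tail n (m - n)); first exact: tailP.
apply/funext => x; rewrite /sum_blocks /tail /=.
rewrite -[in LHS](subnKC nm) big_split_ord /= [LHS]addrC [LHS]addKr.
by apply: eq_bigr.
Qed.

(** The block diagonal sum of the T k converges in B.  Quasi-norm convergence
    implies convergence of the images under functionals
    ([functional_le_qnorm]), so seen through functionals the limit L has
    the T k as its diagonal blocks. *)
Lemma glue_blocks : exists2 L : LX -> LY, opmem B L &
  forall k (f : Y k -> KK) (x : X k), bounded_operator f ->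
    f (linf_proj k (L (@linf_inj _ _ _ X k x))) = f (T x).
Proof.
have k0 : 0 < 2 * kappa by move: kappa1; lra.
have r1 n : (2 * kappa)^-1 ^+ n <= 2^-1 ^+ n :> R.
  apply: lerXn2r; rewrite ?nnegrE ?invr_ge0 ?(ltW k0)//.
  by rewrite lef_pV2 ?posrE//; move: kappa1; lra.
have sB m : opmem B (sum_blocks m) by case: (tailP m 0).
have [|L LB Ll] := @ideal_complete _ _ _ BI LX LY sum_blocks sB.
  move=> e e0; have [N HN] := half_small (2 * kappa) e0.
  have le n m : (N <= n)%N -> (n <= m)%N ->
      opmem B (sum_blocks m \- sum_blocks n) /\
      qnorm B (sum_blocks m \- sum_blocks n) <= e.
    move=> Nn nm; have [h1 h2] := sum_blocks_sub nm; split=> //.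
    apply: le_trans h2 _; apply: le_trans (HN n Nn).
    by rewrite ler_pM2l.
  exists N => m n Nm Nn; have [mn|nm] := leqP m n; last by case: (le n m Nn (ltnW nm)).
  have [h1 h2] := le m n Nm mn.
  have [_] := ideal_scale BI (-1) h1.
  rewrite normrN normr1 -(emb1 R s) embK mul1r => h3.
  apply: le_trans h2; apply: le_trans h3; rewrite le_eqVlt; apply/orP; left.
  by apply/eqP; congr (qnorm B _); apply/funext => x /=; rewrite emb1 scaleN1r opprB.
exists L => // k f x bf.
apply/eqP; rewrite -subr_eq0; apply/eqP; apply: rnorm0_eq0; apply/eqP.
rewrite eq_le rnorm_ge0 andbT; apply/ler_addgt0Pr => e e0; rewrite add0r.
pose f' := f \o @linf_proj _ _ _ Y k.
have bf' : bounded_operator f' := bounded_comp (bounded_linf_proj Y k) bf.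
pose c := opnorm f' * rnorm (@linf_inj _ _ _ X k x) + 1.
have c1 : 0 < c by rewrite ltr_wpDl// mulr_ge0 ?opnorm_ge0 ?rnorm_ge0.
have [N HN] := Ll _ (divr_gt0 e0 c1).
pose m := maxn N k.+1.
have [D1 _] := ideal_scale BI (-1) LB.
have mB : opmem B (sum_blocks m \- L).
  rewrite (_ : _ \- _ = sum_blocks m \+ (fun x => (-1) *: L x)); last first.
    by apply/funext => z /=; rewrite scaleN1r.
  exact: (ideal_add BI).
have := functional_le_qnorm BI (@linf_inj _ _ _ X k x) mB bf'.
have -> : f' ((sum_blocks m \- L) (@linf_inj _ _ _ X k x)) =
    f (T x) - f (linf_proj k (L (@linf_inj _ _ _ X k x))).
  rewrite [LHS](linear_sub bf'.1) /f' /=; congr (f _ - _).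
  have km : (k < m)%N by rewrite leq_max leqnn orbT.
  rewrite /sum_blocks /tail (linear_sum_ord (bounded_linf_proj Y k).1).
  rewrite (bigD1 (Ordinal km))//= add0n !single_eq big1 ?addr0// => j jk.
  exact: single_neq.
rewrite rnormC => /le_trans; apply.
have hq := HN m (leq_maxl _ _).
apply: (@le_trans _ _ (c * qnorm B (sum_blocks m \- L))).
  by rewrite ler_wpM2r ?(ideal_qnorm_ge0 BI)// lerDl.
by rewrite -ler_pdivlMl// mulrC.
Qed.

End Blocks.

Lemma summing_system_linf (X Y : nat -> banach R s) k n (h : 'I_n -> X k)
  (phi : 'I_n -> Y k -> KK) : summing_system h phi ->
  summing_system (fun i => @linf_inj _ _ _ X k (h i))
    (fun i (y : linf Y : banach R s) => phi i (linf_proj k y)).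
Proof.
move=> [[psi [bpsi psih]] [y0 phiy] bphi phi1 hK]; split.
- exists (fun i (x : linf X : banach R s) => psi i (linf_proj k x)); split=> [i|i j].
    exact: (bounded_comp (bounded_linf_proj X k) (bpsi i)).
  by rewrite linf_injK.
- by exists (fun i => @linf_inj _ _ _ Y k (y0 i)) => i j; rewrite linf_injK.
- by move=> i; exact: (bounded_comp (bounded_linf_proj Y k) (bphi i)).
- by move=> e y; apply: le_trans (phi1 e _) _; exact: rnorm_lval.
move=> a; apply: le_trans (hK a).
rewrite -(rnorm_linf_inj (\sum_(i < n) (a i : K) *: h i)).
rewrite (linear_sum_ord (linf_inj_linear (k:=k))) le_eqVlt; apply/orP; left.
apply/eqP; congr rnorm; apply: eq_bigr => i _.
by rewrite (linear_scale (linf_inj_linear (k:=k))).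
Qed.

(** Bundled so that sequences of operators and test systems can be chosen. *)
Record test_data := TestData {
  td_X : banach R s;
  td_Y : banach R s;
  td_T : td_X -> td_Y;
  td_n : nat;
  td_h : 'I_td_n -> td_X;
  td_phi : 'I_td_n -> td_Y -> KK
}.

(** This is |tr (T V)| for V = sum_i phi_i (x) h_i. *)
Definition test_value (d : test_data) : R :=
  rnorm (\sum_(i < td_n d) td_phi i (td_T (td_h i)) : KK).

(** Otherwise there are, for each k, data of quasi-norm at most (2 kappa) ^ -k
    and test value at least k.  All these test values occur for the operator L
    of [glue_blocks], and they are bounded as L belongs to L_infty. *)
Lemma test_le_qnorm : class_le B (L_infty R s) ->
  exists2 c : R, 0 <= c & forall d : test_data,
    summing_system (@td_h d) (@td_phi d) -> opmem B (@td_T d) ->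
    test_value d <= c * qnorm B (@td_T d).
Proof.
move=> BL; apply: contrapT => noc.
have [kappa kappa1 kappaP] := ideal_qnorm_add BI.
have k0 : 0 < 2 * kappa by lra.
have ex (k : nat) : exists d : test_data,
    [/\ summing_system (@td_h d) (@td_phi d), opmem B (@td_T d),
        qnorm B (@td_T d) <= (2 * kappa)^-1 ^+ k & k%:R <= test_value d].
  pose r := (2 * kappa)^-1 ^+ k; have r0 : 0 < r by rewrite exprn_gt0// invr_gt0.
  pose c := (k%:R + 1) / r; have c0 : 0 < c by rewrite divr_gt0// ltr_wpDl.
  have [d [ss TB bd]] : exists d : test_data, [/\ summing_system (@td_h d) (@td_phi d),
      opmem B (@td_T d) & c * qnorm B (@td_T d) < test_value d].
    apply: contrapT => nod; apply: noc; exists c; first exact: ltW.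
    move=> d ss TB; rewrite leNgt; apply/negP => bd; apply: nod; exists d; split=> //.
  have b0 := ideal_qnorm_ge0 BI TB.
  have v0 : 0 < test_value d by apply: le_lt_trans bd; rewrite mulr_ge0// ltW.
  (* l rescales the test value to c r = k + 1, and the quasi-norm, which is
     below test_value d / c, to at most r. *)
  pose l := c * r / test_value d.
  have l0 : 0 <= l by apply: divr_ge0; [apply: mulr_ge0|]; exact: ltW.
  have [lB lq] := ideal_scale BI (emb l) TB.
  have bT := ideal_bounded BI TB.
  exists (@TestData _ _ (fun x => emb l *: @td_T d x) _ (@td_h d) (@td_phi d)); split=> //=.
    apply: le_trans lq _; rewrite res_norm_emb//.
    rewrite /l mulrAC ler_pdivrMr// (mulrC c) -mulrA ler_pM2l//; exact: ltW.
  have -> : test_value (TestData (fun x => emb l *: @td_T d x) (@td_h d) (@td_phi d)) =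
      l * test_value d.
    rewrite /test_value /= -[X in _ = X * _](res_norm_emb s l0) -rnormZ; congr rnorm.
    rewrite scaler_sumr; apply: eq_bigr => i _.
    by have [_ _ bphi _ _] := ss; rewrite (linear_scale (bphi i).1).
  rewrite /l divfK ?gt_eqF// /c divfK ?gt_eqF//; lra.
have [d dP] := choice ex.
have [L LB Lf] := glue_blocks kappa1 kappaP (T := fun k => @td_T (d k))
  (fun k => let: And4 _ h _ _ := dP k in h) (fun k => let: And4 _ _ h _ := dP k in h).
have [bL [M LM]] := BL _ _ _ LB.
pose k := (Num.truncn (2 * M)).+1.
have [ss _ _ kv] := dP k.
have := trace_bound (summing_system_linf ss) bL LM.
rewrite (eq_bigr (fun i => td_phi i (td_T (td_h i)))); last first.
  by move=> i _; apply: Lf; case: ss.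
rewrite -/(test_value (d k)) => vM.
have := truncnS_gt (2 * M); rewrite -/k.
by rewrite ltNge (le_trans kv vM).
Qed.

End Gluing.

(** * The product with the Hilbert-factorable operators *)

Section HilbertProduct.
Variables (R : realType) (s : scalars).
Local Notation K := (scalarK R s).
Local Notation KK := (scalar_space R s : banach R s).
Implicit Types W X Y Z H : banach R s.
Variables (B : operator_class R s) (BI : quasi_banach_ideal B).
Local Notation L2 := (hilbert_factorable R s).
Local Notation BL2 := (ideal_prod B L2).

Lemma hilbert_qnorm_ge0 X Z (S : X -> Z) : opmem L2 S -> 0 <= qnorm L2 S.
Proof.
move=> [H [S' [Q' S'Q']]]; apply: lb_le_inf.
  by exists (opnorm Q' * opnorm S'), H, S', Q'.
by move=> _ [H' [S1 [Q1 [_ ->]]]]; rewrite mulr_ge0 ?opnorm_ge0.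
Qed.

Lemma hilbert_prod_le X H Y (S : X -> H) (Q : H -> Y) :
  is_hilbert H -> bounded_operator S -> opmem B Q ->
  opmem BL2 (Q \o S) /\ qnorm BL2 (Q \o S) <= qnorm B Q * opnorm S.
Proof.
move=> hH bS QB.
have SL : opmem L2 S by exists H, S, id; split=> //; exact: bounded_id.
split; first by exists H, S, Q.
apply: (@le_trans _ _ (qnorm B Q * qnorm L2 S)).
  apply: ge_inf; last by exists H, S, Q.
  exists 0 => _ [Z [S1 [Q1 [S1L Q1B _ ->]]]].
  by rewrite mulr_ge0 ?hilbert_qnorm_ge0// (ideal_qnorm_ge0 BI).
rewrite ler_wpM2l ?(ideal_qnorm_ge0 BI)//.
apply: (@le_trans _ _ (opnorm (@id H) * opnorm S)).
  apply: ge_inf; first by exists 0 => _ [H' [S1 [Q1 [_ ->]]]]; rewrite mulr_ge0 ?opnorm_ge0.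
  by exists H, S, id; split=> //; split=> //; exact: bounded_id.
by rewrite ler_piMl ?opnorm_ge0// opnorm_id.
Qed.

(** The Hilbert space in a factorization of S can serve as the middle space,
    because the rest of S can be moved into the factor from B. *)
Lemma hilbert_prod_factor X Y (T : X -> Y) (c : R) :
  opmem BL2 T -> qnorm BL2 T < c ->
  exists H (S : X -> H) (Q : H -> Y),
    [/\ is_hilbert H, bounded_operator S, opmem B Q, T = Q \o S &
        qnorm B Q * opnorm S < c].
Proof.
move=> [Z0 [S0 [Q0 [S0L Q0B T0]]]] Tc.
have [_ [Z [S [Q [SL QB TE ->]]]] rc] : exists2 r, [set r : R |
    exists (Z : banach R s) (S : X -> Z) (Q : Z -> Y),
      [/\ opmem L2 S, opmem B Q, T = Q \o S & r = qnorm B Q * qnorm L2 S]] r & r < c.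
  by apply: inf_lt => //; exists (qnorm B Q0 * qnorm L2 S0), Z0, S0, Q0.
have b0 := ideal_qnorm_ge0 BI QB; set b := qnorm B Q in rc b0.
have b1 : 0 < b + 1 by rewrite ltr_wpDl.
have [H0 [S0' [Q0' S0Q0]]] := SL.
(* d is so small that b (L_2(S) + d) < c; adding 1 to b admits b = 0. *)
pose d := (c - b * qnorm L2 S) / (b + 1).
have d0 : 0 < d by rewrite divr_gt0// subr_gt0.
have [_ [H [S1 [Q1 [[hH bS1 bQ1 SE] ->]]]] rd] : exists2 r, [set r : R |
    exists (H : banach R s) (S' : X -> H) (Q' : H -> Z),
      [/\ is_hilbert H, bounded_operator S', bounded_operator Q' & S = Q' \o S'] /\
      r = opnorm Q' * opnorm S'] r & r < qnorm L2 S + d.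
  apply: inf_lt; last by rewrite ltrDl.
  by exists (opnorm Q0' * opnorm S0'), H0, S0', Q0'.
have [QQ qQ] := ideal_comp_le BI bQ1 QB (bounded_id Y) (opnorm_id Y) (lexx _).
exists H, S1, (id \o Q \o Q1); split=> //; first by rewrite TE SE.
apply: (@le_lt_trans _ _ (b * (opnorm Q1 * opnorm S1))).
  by rewrite mulrA ler_wpM2r ?opnorm_ge0//; move: qQ; rewrite mul1r.
apply: (@le_lt_trans _ _ (b * (qnorm L2 S + d))).
  by rewrite ler_wpM2l// ltW.
have : b * d < c - b * qnorm L2 S.
  by rewrite /d mulrCA gtr_pMr ?subr_gt0// ltr_pdivrMr// mul1r ltrDl.
by rewrite mulrDr; lra.
Qed.

End HilbertProduct.

Section Diagonal.
Variables (R : realType) (s : scalars).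
Local Notation K := (scalarK R s).
Local Notation KK := (scalar_space R s : banach R s).
Variables (B : operator_class R s) (BI : quasi_banach_ideal B).
Local Notation BL2 := (ideal_prod B (hilbert_factorable R s)).
Variable n : nat.
Local Notation LX := (linf (fun _ : 'I_n => KK) : banach R s).
Local Notation l1 := (seq_space s (sum_norm R n) : banach R s).
Local Notation l2 m := (seq_space s (euclidean_norm R m) : banach R s).

Definition linf_coord (i : 'I_n) (x : LX) : KK := linf_proj i x.

Lemma bounded_linf_coord i : bounded_operator (linf_coord i).
Proof. exact: bounded_linf_proj. Qed.

Definition coord_rank_one (i : 'I_n) (x : LX) : l1 :=
  (linf_coord i x : K) *: basis_vector s (sum_norm R n) i.

Definition coord_sum (r : seq 'I_n) (x : LX) : l1 := \sum_(i <- r) coord_rank_one i x.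

(** The scalar field is represented by the one-dimensional Euclidean space, so
    that the factorization runs through a Hilbert space. *)
Lemma qnorm_coord_rank_one i :
  opmem BL2 (coord_rank_one i) /\ qnorm BL2 (coord_rank_one i) <= 1.
Proof.
pose e : l2 1 := basis_vector s (euclidean_norm R 1) ord0.
pose S (x : LX) : l2 1 := (linf_coord i x : K) *: e.
pose c (z : l2 1) : KK := coord ord0 z.
pose Q (z : l2 1) : l1 := (c z : K) *: basis_vector s (sum_norm R n) i.
have e1 : rnorm e <= 1 := rnorm_basis s (euclidean_norm R 1) ord0.
have bc : bounded_operator c by exact: bounded_coord.
have [QB qQ] := ideal_rank_one BI (basis_vector s (sum_norm R n) i) bc.
have bS : bounded_operator S := bounded_comp (bounded_linf_coord i) (bounded_line e).
have -> : coord_rank_one i = Q \o S.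
  apply/funext => x; rewrite /Q /= /S (linear_scale bc.1) /c coord_basis eqxx.
  by rewrite /GRing.scale /= mulr1.
have [h1 h2] := hilbert_prod_le BI (euclidean_hilbert R s 1) bS QB.
split=> //; apply: le_trans h2 _; apply: mulr_ile1; rewrite ?opnorm_ge0 ?(ideal_qnorm_ge0 BI)//.
  apply: le_trans qQ _; apply: mulr_ile1; rewrite ?rnorm_ge0 ?opnorm_ge0 ?rnorm_basis//.
  by apply: opnorm_le => // x; rewrite mul1r; exact: rnorm_coord.
apply: opnorm_le => // x; rewrite mul1r /S rnormZ.
apply: (@le_trans _ _ (rnorm (linf_coord i x))); last exact: rnorm_lval.
by rewrite ler_piMr// rnorm_ge0.
Qed.

(** The triangle inequality of A speaks only of members of A.  The sums belong
    to A because a single Euclidean space carries all their summands. *)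
Lemma coord_sum_mem r : opmem BL2 (coord_sum r).
Proof.
pose S (x : LX) : l2 n :=
  \sum_(i < n) (linf_coord i x : K) *: basis_vector s (euclidean_norm R n) i.
pose Q (z : l2 n) : l1 :=
  \sum_(i <- r) (coord i z : K) *: basis_vector s (sum_norm R n) i.
have bS : bounded_operator S.
  by apply: bounded_sum => i; exact: (bounded_comp (bounded_linf_coord i) (bounded_line _)).
have QB : opmem B Q.
  rewrite /Q {Q}; elim: r => [|i r IH].
    rewrite (_ : (fun z => _) = fun=> 0); first by case: (ideal_zero BI (l2 n) l1).
    by apply/funext => z; rewrite big_nil.
  have [h _] := ideal_rank_one BI (basis_vector s (sum_norm R n) i)
    (bounded_coord s (euclidean_norm R n) i).
  have := ideal_add BI h IH; congr (opmem B _).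
  by apply/funext => z; rewrite big_cons.
have -> : coord_sum r = Q \o S.
  apply/funext => x; rewrite /coord_sum /Q /=; apply: eq_bigr => i _; congr (_ *: _).
  have lc := @coord_linear R s n (euclidean_norm R n) i.
  rewrite /S (linear_sum_ord lc) (bigD1 i)//= (linear_scale lc) coord_basis eqxx big1.
    by rewrite addr0 /GRing.scale /= mulr1.
  by move=> j ji; rewrite (linear_scale lc) coord_basis eq_sym (negPf ji) scaler0.
by case: (hilbert_prod_le BI (euclidean_hilbert R s n) bS QB).
Qed.

Lemma qnorm_coord_sum r : one_banach BL2 -> qnorm BL2 (coord_sum r) <= (size r)%:R.
Proof.
move=> /(_ LX l1)[_ ZA DA]; elim: r => [|i r IH].
  have := ZA 0 _ (coord_sum_mem [::]).
  have -> : res `|0 : K| = 0 by rewrite normr0 -(emb0 R s) embK.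
  rewrite mul0r => z; rewrite (_ : coord_sum [::] = fun x => 0 *: coord_sum [::] x) ?z//.
  by apply/funext => x; rewrite scale0r /coord_sum big_nil.
have [h1 h2] := qnorm_coord_rank_one i.
have := DA _ _ h1 (coord_sum_mem r).
rewrite (_ : coord_sum (i :: r) = coord_rank_one i \+ coord_sum r); last first.
  by apply/funext => x; rewrite /coord_sum big_cons.
move=> /le_trans; apply; rewrite /= -natr1 addrC; exact: lerD.
Qed.

Lemma coord_coord_sum i x : coord i (coord_sum (index_enum 'I_n) x) = linf_coord i x.
Proof.
have lc := @coord_linear R s n (sum_norm R n) i.
rewrite /coord_sum (linear_sum_ord lc) (bigD1 i)//= (linear_scale lc) coord_basis eqxx big1.
  by rewrite addr0 /GRing.scale /= mulr1.
by move=> j ji; rewrite (linear_scale lc) coord_basis eq_sym (negPf ji) scaler0.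
Qed.

End Diagonal.

(** * The identity from l_infty^n to l_1^n *)

Section OrthonormalTest.
Variables (R : realType) (s : scalars).
Local Notation K := (scalarK R s).
Local Notation KK := (scalar_space R s : banach R s).
Variables (H : banach R s) (ip : H -> H -> K) (ipP : inner_product ip).
Variable n : nat.
Local Notation l1 := (seq_space s (sum_norm R n) : banach R s).

Lemma orthonormal_summing_system (h : 'I_n -> H) : orthonormal_family ip h ->
  summing_system h (fun i (y : l1) => coord i y).
Proof.
move=> oh; split.
- exists (fun i x => ip x (h i)); split=> [i|i j].
    by apply: (bounded_ip ipP); rewrite oh eqxx.
  by rewrite oh eq_sym.
- by exists (basis_vector s (sum_norm R n)) => i j; exact: coord_basis.
- by move=> i; exact: bounded_coord.
- move=> e y; rewrite [leRHS]rnorm_seq_space; apply: le_trans (rnorm_sum_ord _) _.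
  apply: ler_sum => i _; rewrite rnormZ normrX normrN normr1 expr1n.
  by rewrite -(emb1 R s) embK mul1r.
move=> a; apply: (khinchine (inner_product_parallelogram (scalar_inner_product R s))).
  exact: rnorm_ge0.
exact: (orthonormal_pythagoras ipP).
Qed.

(** The average of |S (sum_i +-x_i)| ^ 2 over all signs is the left side. *)
Lemma square_sum_le (X : banach R s) (x : 'I_n -> X) (S : X -> H) :
  bounded_operator S -> (forall e, rnorm (signed_sum x e) <= 1) ->
  \sum_(i < n) rnorm (S (x i)) ^+ 2 <= opnorm S ^+ 2.
Proof.
move=> bS x1.
rewrite -(sign_avg_square (inner_product_parallelogram ipP)) -[leRHS](sign_avg_cst n).
apply: sign_avg_le => e.
have -> : signed_sum (fun i => S (x i)) e = S (signed_sum x e).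
  rewrite /signed_sum (linear_sum_ord bS.1); apply: eq_bigr => i _.
  by rewrite (linear_scale bS.1).
rewrite ler_sqr ?nnegrE ?rnorm_ge0 ?opnorm_ge0//.
by apply: le_trans (opnormP bS _) _; rewrite ler_piMr ?opnorm_ge0.
Qed.

End OrthonormalTest.

(** The convexity of 1 / t, by the pointwise bound
    2 m ^ 3 / t >= 3 m ^ 2 - t ^ 2, which is an equality at t = m. *)
Lemma sum_inv_ge (R : realType) n (t c : 'I_n -> R) (m : R) : 0 < m ->
  (forall i, 0 < t i) -> (forall i, (t i)^-1 <= c i) ->
  \sum_(i < n) t i ^+ 2 <= n%:R * m ^+ 2 -> n%:R <= m * \sum_(i < n) c i.
Proof.
move=> m0 t0 tc tn.
have m3 : 0 < 2 * m ^+ 2 by rewrite mulr_gt0// exprn_gt0.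
have pt i : 3 * m ^+ 2 + (-1) * t i ^+ 2 <= 2 * m ^+ 2 * (m * c i).
  apply: (@le_trans _ _ (2 * m ^+ 2 * (m * (t i)^-1))); last first.
    by rewrite ler_pM2l// ler_pM2l.
  rewrite !mulrA ler_pdivlMr// -subr_ge0.
  rewrite (_ : _ - _ = (t i - m) ^+ 2 * (t i + 2 * m)); last by ring.
  by apply: mulr_ge0; [exact: sqr_ge0|rewrite addr_ge0 ?mulr_ge0 ?ltW].
have : \sum_(i < n) (3 * m ^+ 2 + (-1) * t i ^+ 2) <=
    \sum_(i < n) 2 * m ^+ 2 * (m * c i).
  by apply: ler_sum => i _.
rewrite big_split /= sumr_const card_ord -!mulr_sumr -mulr_natl => h.
rewrite -(ler_pM2l m3); lra.
Qed.

Section Contradiction.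
Variables (R : realType) (s : scalars).
Local Notation K := (scalarK R s).
Local Notation KK := (scalar_space R s : banach R s).
Variables (B : operator_class R s) (BI : quasi_banach_ideal B).

(** The operator of d is the factor Q of the identity = Q S, and sigma is |S|.
    The identity acts on K ^ n with n = N ^ 2, so that sqrt n = N. *)
Lemma exists_large_test_data N : (0 < N)%N ->
  one_banach (ideal_prod B (hilbert_factorable R s)) ->
  exists d : test_data R s, [/\ summing_system (@td_h _ _ d) (@td_phi _ _ d),
    opmem B (@td_T _ _ d) &
    exists2 sigma, 0 < sigma &
      N%:R ^+ 3 <= sigma * test_value d /\
      qnorm B (@td_T _ _ d) * sigma <= 2 * N%:R ^+ 2].
Proof.
move=> N0 one; pose n := (N ^ 2)%N.
pose LX : banach R s := linf (fun _ : 'I_n => KK).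
pose l1 : banach R s := seq_space s (sum_norm R n).
have n0 : (0 : R) < n%:R by rewrite ltr0n expn_gt0 N0.
have Tn := qnorm_coord_sum BI (n := n) (index_enum 'I_n) one.
rewrite -[size _]/(size (index_enum _)) in Tn.
have Tn2 : qnorm (ideal_prod B (hilbert_factorable R s))
    (coord_sum (R := R) (s := s) (index_enum 'I_n)) < 2 * n%:R.
  apply: le_lt_trans Tn _.
  have -> : size (index_enum 'I_n) = n by rewrite -[RHS]card_ord cardE enumT.
  by rewrite mulr_natl mulr2n ltrDl.
have [H [S [Q [hH bS QB TE QS]]]] := hilbert_prod_factor BI (coord_sum_mem BI _) Tn2.
have [ip ipP] := hilbert_inner_product hH.
have bQ := ideal_bounded BI QB.
pose x i : LX := @linf_inj _ _ _ (fun _ : 'I_n => KK) i (1 : K).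
pose r i (z : H) : KK := coord i (Q z).
have lr i : linear (r i).
  by move=> a y z; rewrite /r bQ.1; exact: coord_linear.
have rS i j : r i (S (x j)) = if i == j then (1 : K) else 0.
  have -> : r i (S (x j)) = coord i ((Q \o S) (x j)) by [].
  rewrite -TE coord_coord_sum /linf_coord /=; case: eqP => [->|/eqP ij].
    exact: single_eq.
  by rewrite single_neq// eq_sym.
have x1 e : rnorm (signed_sum x e) <= 1.
  rewrite rnorm_linf; apply: linf_rnorm_le => // i.
  rewrite -[lval _ i]/(linf_proj i _) /signed_sum.
  rewrite (linear_sum_ord (bounded_linf_proj (fun _ : 'I_n => KK) i).1) (bigD1 i)//= big1.
    rewrite addr0 single_eq rnormZ normrX normrN normr1 expr1n.
    by rewrite /rnorm normr1 -(emb1 R s) embK mulr1.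
  by move=> j ji; rewrite single_neq// scaler0.
have [h oh hc] := gram_schmidt ipP lr rS.
have [c tc rc] : exists2 c : 'I_n -> R, forall i, (rnorm (S (x i)))^-1 <= c i &
    forall i, r i (h i) = emb (c i).
  have cP i : {c : R | (rnorm (S (x i)))^-1 <= c /\ r i (h i) = emb c}.
    by apply: cid; have [c0 ? ?] := hc i; exists c0.
  by exists (fun i => projT1 (cP i)) => i; case: (projT2 (cP i)).
have t0 i : 0 < rnorm (S (x i)).
  rewrite lt_def rnorm_ge0 andbT; apply/eqP => /rnorm0_eq0 Sx0.
  have := rS i i; rewrite Sx0 (linear_zero (lr i)) eqxx => /esym/eqP.
  by rewrite oner_eq0.
have Sx := square_sum_le ipP bS x1.
set sigma := opnorm S in Sx.
have s0 : 0 < sigma.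
  rewrite lt_def opnorm_ge0 andbT; apply/eqP => sig0.
  move: Sx; rewrite sig0 expr0n /=; apply/negP; rewrite -ltNge.
  have i0 : 'I_n by exists 0%N; rewrite expn_gt0 N0.
  rewrite (bigD1 i0)//= ltr_pwDl ?exprn_gt0//.
  by apply: sumr_ge0 => i _; exact: sqr_ge0.
have N1 : (0 : R) < N%:R by rewrite ltr0n.
have nN : n%:R = N%:R ^+ 2 :> R by rewrite natrX.
have m0 : 0 < sigma / N%:R by rewrite divr_gt0.
(* m = |S| / N is the value that all the |S e_i| would have if they were equal
   and the sum of their squares were |S| ^ 2. *)
have key := sum_inv_ge m0 t0 tc.
rewrite nN expr_div_n [N%:R ^+ 2 * _]mulrC divfK ?expf_eq0 ?gt_eqF// in key.
exists (@TestData R s H l1 Q n h (fun i y => coord i y)); split=> //=.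
  exact: (orthonormal_summing_system ipP oh).
have c0 i : 0 <= c i by apply: le_trans (tc i); rewrite invr_ge0 ltW.
exists sigma => //; split; last by rewrite -nN ltW.
have -> : test_value (@TestData R s H l1 Q n h (fun i y => coord i y)) =
    \sum_(i < n) c i.
  rewrite /test_value /= (eq_bigr (fun i => emb (c i) : KK)); last by move=> i _; exact: rc.
  have -> : \sum_(i < n) (emb (c i) : KK) = (emb (\sum_(i < n) c i) : K).
    by rewrite emb_sum.
  by rewrite -[LHS]/(res `|_|) res_norm_emb// sumr_ge0.
have := ler_wpM2l (ltW N1) (key Sx); rewrite -exprS => /le_trans; apply.
by rewrite !mulrA (mulrC N%:R) mulfK ?gt_eqF.
Qed.

End Contradiction.

Theorem theorem3p4 (R : realType) (s : scalars) (B : operator_class R s)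
  (B_ideal : quasi_banach_ideal B)
  (B_ultrastable : ultrastable B)
  (B_le_L_infty : class_le B (L_infty R s))
  (BL2_right_accessible :
     right_accessible (ideal_prod B (hilbert_factorable R s))) :
  ~ one_banach (ideal_prod B (hilbert_factorable R s)).
Proof.
move=> one.
have [c c0 cP] := test_le_qnorm B_ideal B_le_L_infty.
(* The two bounds of the test value force N <= 2 c. *)
pose N := (Num.truncn (2 * c)).+1.
have cN : 2 * c < N%:R := truncnS_gt (2 * c).
have [//|d [ss TB [sigma s0 [low up]]]] := @exists_large_test_data R s B B_ideal N _ one.
have N0 : (0 : R) < N%:R ^+ 2 by rewrite exprn_gt0// ltr0n.
have h1 : sigma * test_value d <= sigma * (c * qnorm B (@td_T _ _ d)).
  by rewrite ler_pM2l// cP.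
have h2 : c * (qnorm B (@td_T _ _ d) * sigma) <= c * (2 * N%:R ^+ 2).
  exact: ler_wpM2l.
have : N%:R * N%:R ^+ 2 <= 2 * c * N%:R ^+ 2 :> R.
  by rewrite -exprS; lra.
by rewrite ler_pM2r// leNgt cN.
Qed.
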